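(* Let $(P,[\cdot,\cdot])$ be a Leibniz manifold and let $G$ be a Lie group acting on $P$ in such a way that the orbit space $P/G$ is a regular quotient manifold. Let $\pi:P\to P/G$ be the projection. Assume that the $G$-action is a weak symmetry of $(P,[\cdot,\cdot])$. Then: (i) $(P/G,[\cdot,\cdot]_{P/G})$ is a Leibniz manifold with bracket $[\cdot,\cdot]_{P/G}$ uniquely determined by $$[f,g]_{P/G}\circ\pi=[\pi^{\ast}f,\pi^{\ast}g]\qquad\text{for any } f,g\in C^{\infty}(P/G).$$ (ii) The Leibniz structure $[\cdot,\cdot]_{P/G}$ is the only one on $P/G$ for which $\pi:P\to P/G$ is a Leibniz map. (iii) Let $h\in C^{\infty}(P)^G$ be a smooth $G$-invariant function and let $h^{P/G}\in C^{\infty}(P/G)$ be the function uniquely determined by $h^{P/G}\circ\pi=h$. Let $X_h$ and $X_{h^{P/G}}$ be the corresponding Leibniz vector fields on $(P,[\cdot,\cdot])$ and $(P/G,[\cdot,\cdot]_{P/G})$, respectively, and let $F_t$ and $F_t^{P/G}$ be their flows. Then $\mathrm{Dom}(F_t)\subset\pi^{-1}(\mathrm{Dom}(F_t^{P/G}))$ and $$F_t^{P/G}\circ\pi(z)=\pi\circ F_t(z)\qquad\text{for any } z\in\mathrm{Dom}(F_t).$$ The vector fields $X_h$ and $X_{h^{P/G}}$ are $\pi$-related.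
   Context: A Leibniz manifold $(P,[\cdot,\cdot])$ is a smooth manifold $P$ with an $\mathbb{R}$-bilinear map $[\cdot,\cdot]:C^{\infty}(P)\times C^{\infty}(P)\to C^{\infty}(P)$ (Leibniz bracket, or Leibniz structure) that is a derivation in each entry: $[fg,h]=[f,h]g+f[g,h]$ and $[f,gh]=g[f,h]+h[f,g]$ (no antisymmetry or Jacobi identity is required). The Leibniz vector field $X_h$ of $h\in C^\infty(P)$ is the unique vector field with $X_h[f]=[f,h]$ for all $f\in C^{\infty}(P)$. A Leibniz map $\phi:(P_1,[\cdot,\cdot]_1)\to(P_2,[\cdot,\cdot]_2)$ is a smooth map with $\phi^{\ast}[f,g]_2=[\phi^{\ast}f,\phi^{\ast}g]_1$ for all $f,g\in C^{\infty}(P_2)$. A $G$-action on $P$ is a weak symmetry of $(P,[\cdot,\cdot])$ if the algebra $C^{\infty}(P)^G$ of $G$-invariant smooth functions is closed under the bracket $[\cdot,\cdot]$. $P/G$ is a regular quotient manifold if it can be endowed with a (unique) smooth structure making $\pi:P\to P/G$ a surjective submersion (this is the case, for instance, when the action is free and proper). For a flow $F_t$ of a vector field, $\mathrm{Dom}(F_t)$ denotes the domain of definition of the time-$t$ (maximal) flow map. Vector fields $X$ on $P_1$ and $Y$ on $P_2$ are $\phi$-related if $T\phi\circ X=Y\circ\phi$. *)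

(* Defs.v *)
From HB Require Import structures.
From mathcomp Require Export all_boot all_order all_algebra generic_quotient.
From mathcomp Require Export all_classical all_reals all_analysis.
Export numFieldNormedType.Exports.

Set Implicit Arguments.
Unset Strict Implicit.
Unset Printing Implicit Defensive.

Import Order.TTheory GRing.Theory Num.Theory.

Local Open Scope classical_set_scope.
Local Open Scope ring_scope.

(** * Smooth functions on open subsets of R^n *)

Section SmoothRn.
Context {R : realType}.

(* All partial derivatives up to order k exist and are continuous on U; only
   used for U open, so the derivatives depend only on the values of f on U. *)
Fixpoint Ck n (k : nat) (U : set 'rV[R]_n) (f : 'rV[R]_n -> R) : Prop :=
  {in U, continuous f} /\
  if k is k'.+1 then
    forall i : 'I_n, {in U, forall x, derivable f x (delta_mx 0 i)} /\
                     Ck k' U (fun x => 'D_(delta_mx 0 i) f x)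
  else True.

Definition smooth_on n (U : set 'rV[R]_n) (f : 'rV[R]_n -> R) : Prop :=
  forall k, Ck k U f.

Definition vsmooth_on m n (U : set 'rV[R]_m) (f : 'rV[R]_m -> 'rV[R]_n) : Prop :=
  forall j : 'I_n, smooth_on U (fun x => f x 0 j).

End SmoothRn.

(** * Smooth manifolds *)

(* The inverse parametrization [cinv] is only meaningful on the image of the
   chart; its values elsewhere are arbitrary. *)
Record chart (R : realType) (T : topologicalType) (n : nat) := Chart {
  cdom : set T;
  cmap : T -> 'rV[R]_n;
  cinv : 'rV[R]_n -> T }.

Section Manifolds.
Context {R : realType}.

Definition cimg (T : topologicalType) n (c : chart R T n) : set 'rV[R]_n :=
  cmap c @` cdom c.

Definition is_chart (T : topologicalType) n (c : chart R T n) : Prop :=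
  [/\ open (cdom c), open (cimg c),
      {in cdom c, cancel (cmap c) (cinv c)},
      {in cdom c, continuous (cmap c)} &
      {in cimg c, continuous (cinv c)}].

Definition smooth_transition (T : topologicalType) n (c c' : chart R T n) : Prop :=
  vsmooth_on (cmap c @` (cdom c `&` cdom c')) (cmap c' \o cinv c).

Definition prod_chart (T T' : topologicalType) m n
    (c : chart R T m) (c' : chart R T' n) : chart R (T * T')%type (m + n) :=
  Chart (cdom c `*` cdom c')
        (fun u => row_mx (cmap c u.1) (cmap c' u.2))
        (fun v => (cinv c (lsubmx v), cinv c' (rsubmx v))).

Definition prod_atlas (T T' : topologicalType) m n
    (A : set (chart R T m)) (A' : set (chart R T' n)) :
    set (chart R (T * T')%type (m + n)) :=
  [set prod_chart c c' | c in A & c' in A'].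

Definition smooth_map (T T' : topologicalType) m n (A : set (chart R T m))
    (A' : set (chart R T' n)) (phi : T -> T') : Prop :=
  continuous phi /\
  forall c c', A c -> A' c' ->
    vsmooth_on (cmap c @` (cdom c `&` phi @^-1` cdom c'))
               (cmap c' \o phi \o cinv c).

End Manifolds.

Record smooth_structure (R : realType) (T : topologicalType) (n : nat) :=
  SmoothStructure {
  atlas : set (chart R T n);
  manifold_hausdorff : hausdorff_space T;
  manifold_second_countable : @second_countable T;
  atlas_chart : forall c, atlas c -> is_chart c;
  atlas_cover : forall x, exists2 c, atlas c & cdom c x;
  atlas_compatible : forall c c', atlas c -> atlas c' -> smooth_transition c c';
  atlas_maximal : forall c, is_chart c ->
    (forall c', atlas c' -> smooth_transition c c' /\ smooth_transition c' c) ->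
    atlas c }.

Section Calculus.
Context {R : realType}.

Definition Cinf (T : topologicalType) n (M : smooth_structure R T n) :
    set (T -> R) :=
  [set f : T -> R | forall c, atlas M c -> smooth_on (cimg c) (f \o cinv c)].

(* Tangent vectors are derivations of C^oo(M) at a point.  They, and the
   brackets below, are carried by total functions of which only the values on
   smooth functions matter; hence [tangent_eq] and [bracket_eq]. *)
Definition tangent_vector (T : topologicalType) n (M : smooth_structure R T n)
    (p : T) (v : (T -> R) -> R) : Prop :=
  (forall (a : R) f g, Cinf M f -> Cinf M g ->
     v (fun x => a * f x + g x) = a * v f + v g) /\
  (forall f g, Cinf M f -> Cinf M g ->
     v (fun x => f x * g x) = v f * g p + f p * v g).

Definition tangent_eq (T : topologicalType) n (M : smooth_structure R T n)
    (v w : (T -> R) -> R) : Prop :=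
  forall f, Cinf M f -> v f = w f.

Definition tangent_map (T T' : topologicalType) (phi : T -> T')
    (v : (T -> R) -> R) : (T' -> R) -> R :=
  fun f => v (f \o phi).

Definition surjective_submersion (T T' : topologicalType) m n
    (M : smooth_structure R T m) (N : smooth_structure R T' n)
    (phi : T -> T') : Prop :=
  [/\ smooth_map (atlas M) (atlas N) phi,
      (forall q, exists p, phi p = q) &
      forall p w, tangent_vector N (phi p) w ->
        exists2 v, tangent_vector M p v & tangent_eq N (tangent_map phi v) w].

Definition vector_field (T : topologicalType) n (M : smooth_structure R T n)
    (X : T -> (T -> R) -> R) : Prop :=
  (forall p, tangent_vector M p (X p)) /\
  (forall f, Cinf M f -> Cinf M (fun p => X p f)).

Definition related (T T' : topologicalType) n (N : smooth_structure R T' n)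
    (phi : T -> T') (X : T -> (T -> R) -> R) (Y : T' -> (T' -> R) -> R) : Prop :=
  forall p, tangent_eq N (tangent_map phi (X p)) (Y (phi p)).

(* The velocity of gamma at s is the tangent vector f |-> (f \o gamma)'(s). *)
Definition integral_curve (T : topologicalType) n (M : smooth_structure R T n)
    (X : T -> (T -> R) -> R) (J : set R) (gamma : R -> T) : Prop :=
  forall s, J s -> {for s, continuous gamma} /\
    forall f, Cinf M f -> is_derive s 1 (f \o gamma) (X (gamma s) f).

Definition flows_to (T : topologicalType) n (M : smooth_structure R T n)
    (X : T -> (T -> R) -> R) (t : R) (z w : T) : Prop :=
  exists (J : set R) (gamma : R -> T),
    [/\ open J, is_interval J, J 0 & J t] /\
    [/\ integral_curve M X J gamma, gamma 0 = z & gamma t = w].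

Definition flow_dom (T : topologicalType) n (M : smooth_structure R T n)
    (X : T -> (T -> R) -> R) (t : R) : set T :=
  [set z | exists w, flows_to M X t z w].

(* The time-t map of the maximal flow; [flow M X t z = z] outside its domain. *)
Definition flow (T : topologicalType) n (M : smooth_structure R T n)
    (X : T -> (T -> R) -> R) (t : R) (z : T) : T :=
  xget z [set w | flows_to M X t z w].

(** * Leibniz manifolds *)

Record leibniz_bracket (T : topologicalType) n (M : smooth_structure R T n)
    (br : (T -> R) -> (T -> R) -> T -> R) : Prop := LeibnizBracket {
  bracket_smooth : forall f g, Cinf M f -> Cinf M g -> Cinf M (br f g);
  bracket_linearl : forall (a : R) f g h, Cinf M f -> Cinf M g -> Cinf M h ->
    br (fun x => a * f x + g x) h = (fun x => a * br f h x + br g h x);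
  bracket_linearr : forall (a : R) f g h, Cinf M f -> Cinf M g -> Cinf M h ->
    br f (fun x => a * g x + h x) = (fun x => a * br f g x + br f h x);
  bracket_leibnizl : forall f g h, Cinf M f -> Cinf M g -> Cinf M h ->
    br (fun x => f x * g x) h = (fun x => br f h x * g x + f x * br g h x);
  bracket_leibnizr : forall f g h, Cinf M f -> Cinf M g -> Cinf M h ->
    br f (fun x => g x * h x) = (fun x => g x * br f h x + h x * br f g x) }.

Definition bracket_eq (T : topologicalType) n (M : smooth_structure R T n)
    (br br' : (T -> R) -> (T -> R) -> T -> R) : Prop :=
  forall f g, Cinf M f -> Cinf M g -> br f g = br' f g.

Definition leibniz_vector_field (T : topologicalType) n
    (M : smooth_structure R T n) (br : (T -> R) -> (T -> R) -> T -> R)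
    (h : T -> R) (X : T -> (T -> R) -> R) : Prop :=
  vector_field M X /\ forall f, Cinf M f -> (fun p => X p f) = br f h.

Lemma leibniz_vector_field_exists (T : topologicalType) n
    (M : smooth_structure R T n) (br : (T -> R) -> (T -> R) -> T -> R) h :
  leibniz_bracket M br -> Cinf M h ->
  leibniz_vector_field M br h (fun p f => br f h p).
Proof.
move=> [brS brDl _ brMl _] hS; split=> //; split; last by move=> f fS; exact: brS.
by move=> p; split=> [a|] f g fS gS; rewrite ?brDl ?brMl.
Qed.

Lemma leibniz_vector_field_unique (T : topologicalType) n
    (M : smooth_structure R T n) (br : (T -> R) -> (T -> R) -> T -> R) h X Y :
  leibniz_vector_field M br h X -> leibniz_vector_field M br h Y ->
  forall p, tangent_eq M (X p) (Y p).
Proof.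
by move=> [_ XE] [_ YE] p f fS; have := XE f fS; rewrite -(YE f fS) => /(congr1 (@^~ p)).
Qed.

Definition leibniz_map (T T' : topologicalType) m n
    (M : smooth_structure R T m) (N : smooth_structure R T' n)
    (br : (T -> R) -> (T -> R) -> T -> R)
    (br' : (T' -> R) -> (T' -> R) -> T' -> R) (phi : T -> T') : Prop :=
  smooth_map (atlas M) (atlas N) phi /\
  forall f g, Cinf N f -> Cinf N g -> br' f g \o phi = br (f \o phi) (g \o phi).

End Calculus.

(** * Lie groups, actions and orbit spaces *)

#[short(type="groupTopologicalType")]
HB.structure Definition GroupTopological := {G of Group G & Topological G}.

Definition lie_group (R : realType) (G : groupTopologicalType) d
    (SG : smooth_structure R G d) : Prop :=
  smooth_map (prod_atlas (atlas SG) (atlas SG)) (atlas SG)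
             (fun u : (G * G)%type => (u.1 * u.2)%g) /\
  smooth_map (atlas SG) (atlas SG) (fun x : G => x^-1%g).

Record group_action (G : groupType) (T : Type) := GroupAction {
  act :> G -> T -> T;
  act1 : forall x, act 1%g x = x;
  actM : forall g h x, act (g * h)%g x = act g (act h x) }.

Definition smooth_action (R : realType) (G : groupTopologicalType) d
    (SG : smooth_structure R G d) (T : topologicalType) n
    (M : smooth_structure R T n) (a : group_action G T) : Prop :=
  smooth_map (prod_atlas (atlas SG) (atlas M)) (atlas M)
             (fun u : (G * T)%type => a u.1 u.2).

Definition invariant_fun (G : groupType) (T V : Type) (a : group_action G T)
    (f : T -> V) : Prop :=
  forall g x, f (a g x) = f x.

Section OrbitSpace.
Context (G : groupType) (T : topologicalType) (a : group_action G T).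

Definition same_orbit (x y : T) : bool := `[< exists g, a g x = y >].

Lemma same_orbit_refl : reflexive same_orbit.
Proof. by move=> x; apply/asboolP; exists 1%g; rewrite act1. Qed.

Lemma same_orbit_sym : symmetric same_orbit.
Proof.
move=> x y; apply/asboolP/asboolP => -[g <-]; exists (g^-1)%g;
  by rewrite -actM mulVg act1.
Qed.

Lemma same_orbit_trans : transitive same_orbit.
Proof.
move=> y x z /asboolP[g <-] /asboolP[h <-].
by apply/asboolP; exists (h * g)%g; rewrite actM.
Qed.

Definition orbit_equiv : equiv_rel T :=
  EquivRel same_orbit same_orbit_refl same_orbit_sym same_orbit_trans.

Definition orbit_space : topologicalType :=
  quotient_topology {eq_quot orbit_equiv}%qT.

Definition orbit_proj : T -> orbit_space := \pi_({eq_quot orbit_equiv})%qT.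

End OrbitSpace.

Definition weak_symmetry (R : realType) (G : groupType) (T : topologicalType) n
    (M : smooth_structure R T n) (br : (T -> R) -> (T -> R) -> T -> R)
    (a : group_action G T) : Prop :=
  forall f g, Cinf M f -> Cinf M g -> invariant_fun a f -> invariant_fun a g ->
    invariant_fun a (br f g).

(* Main.v *)
From HB Require Import structures.
Require Import Defs.
From mathcomp Require Import ring lra.

Set Implicit Arguments.
Unset Strict Implicit.
Unset Printing Implicit Defensive.

Import Order.TTheory GRing.Theory Num.Theory.

Local Open Scope classical_set_scope.
Local Open Scope ring_scope.

(** Write pi for the orbit projection.  Since pi is onto, a function on P/G is
determined by its pullback along pi, and a function on P is such a pullback
exactly when it is invariant.  Weak symmetry says that the bracket of two
pullbacks is again invariant, so it descends to P/G: this defines the reduced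
bracket, and makes it unique, also among the brackets for which pi is a Leibniz
map.  Bilinearity and the two Leibniz rules are identities between functions on
P/G, so they can be checked after pulling back.  For an invariant h the same
formula, read at a point, says that X_h is pi-related to the vector field of the
reduced function, and pi carries integral curves to integral curves.

Two analytic facts are left.

Descent ([Cinf_descent]): if pi is a surjective submersion and k o pi is smooth,
then k is smooth.  Submersions are defined here by lifting derivations, so one
first recovers a Jacobian of full rank ([jac_submersion_row_full]).  If a linear
combination l of the coordinates downstairs had a pullback with vanishing
differential at p, the pullback would be killed by all derivations at p
([tangent_zero_jet], which rests on Hadamard's factorization [hadamard] and on
bump functions [bump_exists]); but the derivative along l does not kill l, and it
lifts to P.  A right inverse of the Jacobian gives an affine slice through p on
which pi becomes a map psi between open sets of the same dimension with
derivative 1 at the base point, and k o psi is smooth.  Now psi is locally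
invertible with a Lipschitz inverse, by contraction.  Differentiating k o psi
shows that the partial derivatives of k, composed with psi, are again smooth, so
that k is C^r for all r by induction ([smooth_descent]).

Uniqueness of integral curves ([flows_to_unique]): it turns the fact that pi
carries integral curves to integral curves into the equation between the two
flow maps.  In a chart the coordinates of an integral curve satisfy an ordinary
differential equation with smooth, hence locally Lipschitz, right-hand side
([chart_ode]); two solutions with a common value agree nearby, and the set where
they agree is open and closed in an interval. *)

(** * Neighbourhoods and continuity *)

Section Neighbourhoods.
Context {R : realType}.

(** Stated for the neighbourhoods of a topological space only, so that the filter
instance is found when T is a space of matrices, whose neighbourhoods would
otherwise be unfolded. *)
Lemma near_mono (T : topologicalType) (x : T) (P Q : T -> Prop) :
  (forall y, P y -> Q y) -> (\forall y \near x, P y) -> \forall y \near x, Q y.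
Proof. by move=> PQ; apply: filterS. Qed.

Lemma near_mono2 (T : topologicalType) (x : T) (P Q S : T -> Prop) :
  (forall y, P y -> Q y -> S y) -> (\forall y \near x, P y) ->
  (\forall y \near x, Q y) -> \forall y \near x, S y.
Proof. by move=> PQS nP; apply: filterS2 nP. Qed.

Lemma continuous_dist (T : topologicalType) (W : normedModType R) (f : T -> W) x :
  (forall e : R, 0 < e -> \forall y \near x, `|f x - f y| < e) ->
  {for x, continuous f}.
Proof. by move=> H; apply/cvgrPdist_lt => e e0; exact: H. Qed.

Lemma near_ballP (V : normedModType R) (x : V) (P : V -> Prop) :
  (\forall y \near x, P y) -> exists2 r : R, 0 < r & forall y, ball x r y -> P y.
Proof. by move=> H; have /nbhs_ballP[r /= r0 rP] : nbhs x P by []; exists r. Qed.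

Lemma near_eq_continuous_at (V W : topologicalType) (f g : V -> W) x :
  (\forall y \near x, f y = g y) -> {for x, continuous f} -> {for x, continuous g}.
Proof.
move=> fg cf; rewrite /prop_for /continuous_at -(nbhs_singleton fg).
exact: cvg_trans (near_eq_cvg fg) cf.
Qed.

End Neighbourhoods.

(** * Closure properties of C^k functions *)

Section CkBasics.
Context {R : realType}.
Implicit Types (n k : nat).

Local Notation e_ i := (delta_mx 0 i).

Lemma Ck_continuous n k (U : set 'rV[R]_n) f x : Ck k U f -> U x ->
  {for x, continuous f}.
Proof. by case: k => [|k] [cf _] Ux; apply: cf; apply/mem_set. Qed.

Lemma Ck_derivable n k (U : set 'rV[R]_n) f x i : Ck k.+1 U f -> U x ->
  derivable f x (e_ i).
Proof. by move=> [_ /(_ i) [df _]] Ux; apply: df; apply/mem_set. Qed.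

Lemma Ck_derive n k (U : set 'rV[R]_n) f i : Ck k.+1 U f ->
  Ck k U (fun x => 'D_(e_ i) f x).
Proof. by move=> [_ /(_ i) []]. Qed.

Lemma CkS_intro n k (U : set 'rV[R]_n) f :
  (forall x, U x -> {for x, continuous f}) ->
  (forall x i, U x -> derivable f x (e_ i)) ->
  (forall i, Ck k U (fun x => 'D_(e_ i) f x)) -> Ck k.+1 U f.
Proof.
move=> cf df Df; split=> [x /set_mem|i]; first exact: cf.
by split=> // x /set_mem; exact: df.
Qed.

Lemma CkW n k (U : set 'rV[R]_n) f : Ck k.+1 U f -> Ck k U f.
Proof.
elim: k f => [|k IH] f Cf; first by case: Cf.
apply: CkS_intro => [x Ux|x i Ux|i].
- exact: Ck_continuous Cf Ux.
- exact: Ck_derivable Cf Ux.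
- by apply: IH; exact: Ck_derive.
Qed.

Lemma smooth_derive n (U : set 'rV[R]_n) f i : smooth_on U f ->
  smooth_on U (fun x => 'D_(e_ i) f x).
Proof. by move=> sf k; apply: Ck_derive; exact: sf. Qed.

Lemma smooth_derivable n (U : set 'rV[R]_n) f x i : smooth_on U f -> U x ->
  derivable f x (e_ i).
Proof. by move=> sf Ux; exact: (@Ck_derivable n 0 U f x i (sf 1%N) Ux). Qed.

Lemma smooth_continuous n (U : set 'rV[R]_n) f x : smooth_on U f -> U x ->
  {for x, continuous f}.
Proof. by move=> sf Ux; exact: (@Ck_continuous n 0 U f x (sf 0%N) Ux). Qed.

Lemma Ck_subset n k (U V : set 'rV[R]_n) f : V `<=` U -> Ck k U f -> Ck k V f.
Proof.
move=> VU; elim: k f => [|k IH] f Cf.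
  by split=> // x /set_mem /VU Ux; exact: Ck_continuous Cf Ux.
apply: CkS_intro => [x /VU Ux|x i /VU Ux|i].
- exact: Ck_continuous Cf Ux.
- exact: Ck_derivable Cf Ux.
- by apply: IH; exact: Ck_derive.
Qed.

Lemma near_open n (U : set 'rV[R]_n) (A : 'rV[R]_n -> Prop) x : open U -> U x ->
  (forall y, U y -> A y) -> \forall y \near x, A y.
Proof. by move=> oU Ux UA; apply: filterS UA _; exact: open_nbhs_nbhs. Qed.

Lemma Ck_eq n k (U : set 'rV[R]_n) f g : open U -> (forall x, U x -> f x = g x) ->
  Ck k U f -> Ck k U g.
Proof.
move=> oU; elim: k f g => [|k IH] f g fg Cf.
  split=> // x /set_mem Ux.
  exact: near_eq_continuous_at (near_open oU Ux fg) (Ck_continuous Cf Ux).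
apply: CkS_intro => [x Ux|x i Ux|i].
- exact: near_eq_continuous_at (near_open oU Ux fg) (Ck_continuous Cf Ux).
- exact: (@near_eq_derivable R _ _ f g x (e_ i) (near_open oU Ux fg) (Ck_derivable Cf Ux)).
- apply: (IH (fun x => 'D_(e_ i) f x)); last exact: Ck_derive.
  by move=> x Ux; exact: (@near_eq_derive R _ _ f g x (e_ i) (near_open oU Ux fg)).
Qed.

Lemma Ck_local n k (U : set 'rV[R]_n) f :
  (forall x, U x -> exists V, [/\ open V, V x & Ck k V f]) -> Ck k U f.
Proof.
elim: k f => [|k IH] f loc.
  by split=> // x /set_mem /loc[V [_ Vx Cf]]; exact: (Ck_continuous Cf).
apply: CkS_intro => [x /loc[V [_ Vx Cf]]|x i /loc[V [_ Vx Cf]]|i].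
- exact: (Ck_continuous Cf).
- exact: (Ck_derivable Cf).
- apply: IH => x /loc[V [oV Vx Cf]]; exists V; split=> //; exact: Ck_derive.
Qed.

Lemma smooth_eq n (U : set 'rV[R]_n) f g : open U -> (forall x, U x -> f x = g x) ->
  smooth_on U f -> smooth_on U g.
Proof. by move=> oU fg sf k; apply: Ck_eq fg (sf k). Qed.

Lemma smooth_subset n (U V : set 'rV[R]_n) f : V `<=` U -> smooth_on U f ->
  smooth_on V f.
Proof. by move=> VU sf k; apply: Ck_subset VU (sf k). Qed.

Lemma smooth_local n (U : set 'rV[R]_n) f :
  (forall x, U x -> exists V, [/\ open V, V x & smooth_on V f]) -> smooth_on U f.
Proof.
move=> loc k; apply: Ck_local => x /loc[V [oV Vx sf]].
by exists V; split=> //; exact: sf.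
Qed.

Lemma Ck_cst n k (U : set 'rV[R]_n) (a : R) : Ck k U (fun=> a).
Proof.
elim: k a => [|k IH] a; first by split=> // x _; exact: cst_continuous.
apply: CkS_intro => [x _|x i _|i]; [exact: cst_continuous|exact: derivable_cst|].
suff -> : (fun x : 'rV[R]_n => 'D_(e_ i) (fun=> a) x) = (fun=> 0) by exact: IH.
by apply: funext => x; exact: derive_cst.
Qed.

Lemma Ck_add n k (U : set 'rV[R]_n) f g : open U -> Ck k U f -> Ck k U g ->
  Ck k U (fun x => f x + g x).
Proof.
move=> oU; elim: k f g => [|k IH] f g Cf Cg.
  split=> // x /set_mem Ux.
  exact: cvgD (Ck_continuous Cf Ux) (Ck_continuous Cg Ux).
apply: CkS_intro => [x Ux|x i Ux|i].
- exact: cvgD (Ck_continuous Cf Ux) (Ck_continuous Cg Ux).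
- exact: derivableD (Ck_derivable Cf Ux) (Ck_derivable Cg Ux).
- apply: Ck_eq (IH _ _ (Ck_derive i Cf) (Ck_derive i Cg)) => // x Ux.
  by rewrite -deriveD //; [exact: Ck_derivable Cf Ux|exact: Ck_derivable Cg Ux].
Qed.

Lemma Ck_mul n k (U : set 'rV[R]_n) f g : open U -> Ck k U f -> Ck k U g ->
  Ck k U (fun x => f x * g x).
Proof.
move=> oU; elim: k f g => [|k IH] f g Cf Cg.
  split=> // x /set_mem Ux.
  exact: cvgM (Ck_continuous Cf Ux) (Ck_continuous Cg Ux).
apply: CkS_intro => [x Ux|x i Ux|i].
- exact: cvgM (Ck_continuous Cf Ux) (Ck_continuous Cg Ux).
- exact: derivableM (Ck_derivable Cf Ux) (Ck_derivable Cg Ux).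
- have Cd := Ck_add oU (IH _ _ (CkW Cf) (Ck_derive i Cg))
                       (IH _ _ (CkW Cg) (Ck_derive i Cf)).
  apply: Ck_eq Cd => // x Ux.
  by rewrite deriveM //; [exact: Ck_derivable Cf Ux|exact: Ck_derivable Cg Ux].
Qed.

(** The derivative of 1/f is - f' / f^2, in which 1/f may be taken to be C^(k-1) by
induction. *)
Lemma Ck_inv n k (U : set 'rV[R]_n) f : open U -> (forall x, U x -> f x != 0) ->
  Ck k U f -> Ck k U (fun x => (f x)^-1).
Proof.
move=> oU f0; elim: k => [|k IH] Cf.
  by split=> // x /set_mem Ux; exact: (cvgV (f0 x Ux) (Ck_continuous Cf Ux)).
apply: CkS_intro => [x Ux|x i Ux|i].
- exact: cvgV (f0 x Ux) (Ck_continuous Cf Ux).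
- exact: derivableV (f0 x Ux) (Ck_derivable Cf Ux).
- have Ci := IH (CkW Cf).
  have Cd := Ck_mul oU (Ck_mul oU (Ck_cst k U (-1)) (Ck_mul oU Ci Ci)) (Ck_derive i Cf).
  apply: Ck_eq Cd => // x Ux.
  rewrite (@deriveV _ _ f x _ (f0 x Ux) (Ck_derivable Cf Ux)) /GRing.scale /=.
  by rewrite -exprVn expr2; ring.
Qed.

Lemma Ck_sum n k (U : set 'rV[R]_n) (I : Type) (r : seq I) (P : pred I)
    (F : I -> 'rV[R]_n -> R) : open U ->
  (forall i, P i -> Ck k U (F i)) -> Ck k U (fun x => \sum_(i <- r | P i) F i x).
Proof.
move=> oU CF; elim: r => [|j r IH].
  by apply: Ck_eq (Ck_cst k U 0) => // x _; rewrite big_nil.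
case: (boolP (P j)) => Pj.
  by apply: Ck_eq (Ck_add oU (CF j Pj) IH) => // x _; rewrite big_cons Pj.
by apply: Ck_eq IH => // x _; rewrite big_cons (negPf Pj).
Qed.

Lemma Ck_prod n k (U : set 'rV[R]_n) (I : Type) (r : seq I) (P : pred I)
    (F : I -> 'rV[R]_n -> R) : open U ->
  (forall i, P i -> Ck k U (F i)) -> Ck k U (fun x => \prod_(i <- r | P i) F i x).
Proof.
move=> oU CF; elim: r => [|j r IH].
  by apply: Ck_eq (Ck_cst k U 1) => // x _; rewrite big_nil.
case: (boolP (P j)) => Pj.
  by apply: Ck_eq (Ck_mul oU (CF j Pj) IH) => // x _; rewrite big_cons Pj.
by apply: Ck_eq IH => // x _; rewrite big_cons (negPf Pj).
Qed.

Lemma is_derive_coord n (x : 'rV[R]_n) (v : 'rV[R]_n) j :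
  is_derive x v (fun y : 'rV[R]_n => y 0 j) (v 0 j).
Proof.
have /derivable_mxP dd := @derivable_id R 'rV[R]_n x v.
split; first exact: (dd 0 j).
by have := derive_mx (@derivable_id R 'rV[R]_n x v);
  rewrite derive_id => /rowP /(_ j); rewrite mxE.
Qed.

Lemma Ck_coord n k (U : set 'rV[R]_n) j : Ck k U (fun x => x 0 j).
Proof.
case: k => [|k]; first by split=> // x _; exact: coord_continuous.
apply: CkS_intro => [x _|x i _|i]; first exact: coord_continuous.
  by case: (is_derive_coord x (e_ i) j).
suff -> : (fun x : 'rV[R]_n => 'D_(e_ i) (fun y : 'rV[R]_n => y 0 j) x) =
  (fun=> (e_ i : 'rV[R]_n) 0 j) by exact: Ck_cst.
by apply: funext => x; case: (is_derive_coord x (e_ i) j).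
Qed.

End CkBasics.

(** * Mean value estimates in several variables *)

Section MeanValue.
Context {R : realType}.
Implicit Types (n k : nat).

Local Notation e_ i := (delta_mx 0 i).

Lemma rV_norm_le n (x : 'rV[R]_n) (e : R) : 0 <= e ->
  (forall j, `|x 0 j| <= e) -> `|x| <= e.
Proof.
move=> e0 xe; rewrite [leLHS]/Num.Def.normr/= mx_normrE (bigmax_le _ e0)//=.
by move=> -[i j] _ /=; rewrite ord1.
Qed.

Lemma rV_coord_le n (x : 'rV[R]_n) j : `|x 0 j| <= `|x|.
Proof.
rewrite [leRHS]/Num.Def.normr/= mx_normrE.
exact: (le_bigmax _ (fun i : 'I_1 * 'I_n => `|x i.1 i.2|) (0, j)).
Qed.

Lemma rV_ballP n (c x : 'rV[R]_n) (r : R) :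
  ball c r x <-> 0 < r /\ forall j, `|c 0 j - x 0 j| < r.
Proof.
split=> [[r0 H]|[r0 H]]; split=> //; first by move=> j; have := H 0 j.
by move=> i j; rewrite ord1; exact: H.
Qed.

Lemma rV_ballE n (c x : 'rV[R]_n) (r : R) : ball c r x = (`|c - x| < r) :> Prop.
Proof. by rewrite mx_norm_ball. Qed.

Lemma derivable_line n (f : 'rV[R]_n -> R) (z v : 'rV[R]_n) (s : R) :
  derivable f (s *: v + z) v ->
  is_derive s 1 (fun t : R => f (t *: v + z)) ('D_v f (s *: v + z)).
Proof.
have E : (fun h : R => h^-1 *: (((fun t : R => f (t *: v + z)) \o shift s) (h *: 1)
            - f (s *: v + z))) =
         (fun h : R => h^-1 *: ((f \o shift (s *: v + z)) (h *: v)
            - f (s *: v + z))).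
  by apply: funext => h /=; rewrite scalerDl [h *: 1]mulr1 addrA.
by move=> df; split; [rewrite /derivable E|rewrite /derive E].
Qed.

(** Reduces a directional derivative to a derivative in one real variable, where
derivability and differentiability coincide. *)
Lemma derive_line0 (W V : normedModType R) (F : W -> V) (x v : W) :
  'D_v F x = 'D_1 (fun h : R => F (h *: v + x)) 0.
Proof.
rewrite /derive; set g1 := fun h => h^-1 *: _; set g2 := fun h => h^-1 *: _.
suff -> : g1 = g2 by [].
by rewrite funeqE /g1 /g2 => h /=; rewrite addr0 scale0r add0r [_%:A]mulr1.
Qed.

Lemma is_derive_sumfun (W : normedModType R) (I : finType) (F : I -> W -> R)
    (x v : W) (dF : I -> R) :
  (forall i, is_derive x v (F i) (dF i)) ->
  is_derive x v (fun y => \sum_i F i y) (\sum_i dF i).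
Proof.
move=> H; elim: (index_enum I) => [|i s IH].
  have -> : (fun y => \sum_(i <- [::]) F i y) = cst 0.
    by apply: funext => y; rewrite big_nil.
  by rewrite big_nil; exact: is_derive_cst.
have -> : (fun y => \sum_(j <- i :: s) F j y) =
    F i + (fun y => \sum_(j <- s) F j y).
  by apply: funext => y; rewrite big_cons.
by rewrite big_cons; exact: is_deriveD.
Qed.

Lemma norm_scale_delta n (h : R) (j : 'I_n) : `|h *: (e_ j : 'rV[R]_n)| <= `|h|.
Proof.
apply: rV_norm_le => // i; rewrite !mxE eqxx /= normrM ler_piMr //.
by case: eqP; rewrite ?normr1 ?normr0.
Qed.

(** The end points are not ordered, so that the estimate applies on both sides of s. *)
Lemma mean_value_itv (g dg : R -> R) (s t a e : R) :
  (forall x, (s <= x <= t) || (t <= x <= s) ->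
     is_derive x 1 g (dg x) /\ `|dg x - a| <= e) ->
  `|g t - g s - a * (t - s)| <= e * `|t - s|.
Proof.
move=> H.
suff [c [Hc E]] : exists c, (s <= c <= t) || (t <= c <= s) /\ g t - g s = dg c * (t - s).
  by rewrite E -mulrBl normrM ler_wpM2r //; case: (H c Hc).
have aux (x y : R) : x <= y -> (forall z : R, x <= z <= y -> is_derive z 1 g (dg z)) ->
    exists2 c, x <= c <= y & g y - g x = dg c * (y - x).
  move=> xy dxy.
  have cont : {within `[x, y], continuous g}.
    apply: derivable_within_continuous => z; rewrite in_itv /= => xzy.
    by case: (dxy z xzy).
  have [||c cxy E] := @MVT_segment R g dg x y xy => //.
    by move=> z; rewrite in_itv /= => /andP[xz zy]; apply: dxy; rewrite !ltW.
  by exists c.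
have [st|/ltW ts] := leP s t.
  have [|c Hc E] := aux s t st; first by move=> z Hz; case: (H z); rewrite ?Hz.
  by exists c; rewrite Hc.
have [|c Hc E] := aux t s ts; first by move=> z Hz; case: (H z); rewrite ?Hz ?orbT.
by exists c; rewrite Hc orbT; split=> //; rewrite -opprB E -mulrN opprB.
Qed.

Lemma mean_value_line n (f : 'rV[R]_n -> R) (z v : 'rV[R]_n) (t a e : R) :
  (forall s, `|s| <= `|t| -> 0 <= s * t ->
     derivable f (s *: v + z) v /\ `|'D_v f (s *: v + z) - a| <= e) ->
  `|f (t *: v + z) - f z - a * t| <= e * `|t|.
Proof.
move=> H.
have between (x : R) : (0 <= x <= t) || (t <= x <= 0) ->
    is_derive x 1 (fun s : R => f (s *: v + z)) ('D_v f (x *: v + z)) /\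
    `|'D_v f (x *: v + z) - a| <= e.
  move=> xt; have [||dfx Dx] := H x; last first.
  - by split; [exact: derivable_line dfx|exact: Dx].
  - case/orP: xt => /andP[h1 h2]; first by rewrite mulr_ge0 // (le_trans h1).
    by rewrite mulr_le0 // (le_trans h1).
  - case/orP: xt => /andP[h1 h2]; first by rewrite !ger0_norm // (le_trans h1).
    by rewrite !ler0_norm ?lerN2 // (le_trans h1).
by have := mean_value_itv between; rewrite scale0r add0r subr0.
Qed.

(** Go from x to y by changing one coordinate at a time: the intermediate points stay
in the ball of the sup norm, and each step is the one-variable mean value theorem.
Bounds on the partial derivatives alone thus control the increment; a = 0 gives
a Lipschitz estimate and a = the partial derivatives at a point gives
differentiability there. *)
Lemma mean_value_ball n (f : 'rV[R]_n -> R) (c : 'rV[R]_n) (r : R) (a : 'I_n -> R)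
    (e : R) :
  (forall x, ball c r x -> forall i, derivable f x (e_ i) /\
     `|'D_(e_ i) f x - a i| <= e) ->
  forall x y, ball c r x -> ball c r y ->
  `|f y - f x - \sum_i a i * (y - x) 0 i| <= e * (n%:R * `|y - x|).
Proof.
move=> H x y Bx By.
(* The k-th intermediate point: the first k coordinates of y, the others of x. *)
pose z k : 'rV[R]_n := \row_j (if (j < k)%N then y 0 j else x 0 j).
have z0 : z 0%N = x by apply/rowP => j; rewrite mxE ltn0.
have zn : z n = y by apply/rowP => j; rewrite mxE ltn_ord.
have zS (i : 'I_n) : z i.+1 = (y - x) 0 i *: e_ i + z i.
  apply/rowP => j; rewrite !mxE eqxx /= ltnS leq_eqVlt.
  case: (eqVneq j i) => [->|ji].
    by rewrite eqxx ltnn /= mulr1 subrK.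
  by rewrite (negPf (_ : (j != i :> nat))) //= mulr0 add0r.
have -> : f y - f x = \sum_(i < n) (f (z i.+1) - f (z i)).
  rewrite -(big_mkord xpredT (fun i => f (z i.+1) - f (z i))).
  by rewrite telescope_sumr// zn z0.
rewrite -sumrB; apply: le_trans (ler_norm_sum _ _ _) _.
rewrite -[n in n%:R]card_ord -sumr_const mulr_suml mulr_sumr ler_sum// => i _.
rewrite mul1r.
have e0 : 0 <= e by case: (H x Bx i) => _; exact: le_trans.
apply: (@le_trans _ _ (e * `|(y - x) 0 i|)); last first.
  by rewrite ler_wpM2l// rV_coord_le.
rewrite zS; apply: mean_value_line => s st s0; apply: H.
have /rV_ballP[r0 Bxj] := Bx; have /rV_ballP[_ Byj] := By.
apply/rV_ballP; split=> // j; rewrite !mxE eqxx /=.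
case: (eqVneq j i) => [->|ji]; last first.
  by rewrite mulr0 add0r; case: ifP.
rewrite ltnn mulr1; move: st s0 (Bxj i) (Byj i); rewrite !mxE.
(* One coordinate of a point between x and y lies between those of x and y. *)
move: (c 0 i) (x 0 i) (y 0 i) => ci xi yi.
rewrite !ltr_norml => st s0 /andP[h1 h2] /andP[h3 h4].
have [yx|yx] := leP 0 (yi - xi).
  move: st; rewrite (ger0_norm yx) ler_norml => /andP[h5 h6].
  have [s1|s1] := leP 0 s; first by apply/andP; split; lra.
  have : yi - xi = 0 \/ 0 < yi - xi by move: yx; rewrite le_eqVlt => /predU1P[<-|]; [left|right].
  case=> [yx0|yx0]; first by apply/andP; split; lra.
  by move: s0; rewrite pmulr_lge0 // leNgt s1.
move: st; rewrite (ltr0_norm yx) ler_norml => /andP[h5 h6].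
have s1 : s <= 0 by move: s0; rewrite nmulr_lge0.
by apply/andP; split; lra.
Qed.

End MeanValue.

(** * Differentiability and composition *)

Section ChainRule.
Context {R : realType}.
Implicit Types (n k : nat).

Local Notation e_ i := (delta_mx 0 i).

Lemma open_ball_sub n (U : set 'rV[R]_n) x : open U -> U x ->
  exists2 r : R, 0 < r & ball x r `<=` U.
Proof.
move=> oU Ux; have /nbhs_ballP[r /= r0 rU] : nbhs x U by exact: open_nbhs_nbhs.
by exists r.
Qed.

Lemma C1_ball n (U : set 'rV[R]_n) f x e : open U -> Ck 1 U f -> U x -> 0 < e ->
  exists r : R, [/\ 0 < r, ball x r `<=` U & forall y, ball x r y -> forall i,
    derivable f y (e_ i) /\ `|'D_(e_ i) f y - 'D_(e_ i) f x| <= e].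
Proof.
move=> oU Cf Ux e0.
have near_i : \forall y \near x, forall i : 'I_n, `|'D_(e_ i) f y - 'D_(e_ i) f x| <= e.
  apply: (@filter_forall _ _ (fun i y => `|'D_(e_ i) f y - 'D_(e_ i) f x| <= e) (nbhs x) _) => i.
  have := Ck_continuous (Ck_derive i Cf) Ux.
  by move/cvgrPdist_le => /(_ e e0); apply: filterS => y; rewrite distrC.
have nU : \forall y \near x, U y by exact: open_nbhs_nbhs.
have [r r0 H] := near_ballP (filterI nU near_i).
exists r; split=> // [y /H[]//|y /H[Uy Dy] i]; split=> //.
exact: Ck_derivable Cf Uy.
Qed.

Definition grad n (f : 'rV[R]_n -> R) x : 'cV[R]_n := \col_i 'D_(e_ i) f x.

Definition differential n (f : 'rV[R]_n -> R) x (v : 'rV[R]_n) : R :=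
  (v *m grad f x) 0 0.

Lemma differential_subproof n (f : 'rV[R]_n -> R) x : linear (differential f x).
Proof. by move=> a u v; rewrite /differential mulmxDl -scalemxAl !mxE. Qed.

HB.instance Definition _ n (f : 'rV[R]_n -> R) x :=
  GRing.isLinear.Build R 'rV[R]_n R _ (differential f x) (differential_subproof f x).

Lemma differentialE n (f : 'rV[R]_n -> R) x v :
  differential f x v = \sum_i v 0 i * 'D_(e_ i) f x.
Proof. by rewrite /differential mxE; apply: eq_bigr => i _; rewrite mxE. Qed.

Lemma is_diff_from_estimate (V W : normedModType R) (f : V -> W)
    (L : {linear V -> W}) (x : V) : continuous L ->
  (forall e : R, 0 < e -> \forall h \near 0, `|f (h + x) - f x - L h| <= e * `|h|) ->
  is_diff x f L.
Proof.
move=> cL est.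
have fL : f \o shift x = cst (f x) + (L : V -> W) +o_ 0 id.
  apply/eqaddoP => e e0; apply: filterS (est e e0) => h.
  by rewrite !fctE /= opprD addrA.
have dE := diff_unique cL fL.
by split; [apply/diff_locallyP; rewrite dE|exact: dE].
Qed.

(** Continuous partial derivatives are within e of their values at x on a small ball,
where [mean_value_ball] bounds the error of the linear approximation. *)
Lemma C1_is_diff n (U : set 'rV[R]_n) f x : open U -> Ck 1 U f -> U x ->
  is_diff x f (differential f x).
Proof.
move=> oU Cf Ux.
pose L : {linear 'rV[R]_n -> R} := differential f x.
have cL : continuous L.
  move=> v; rewrite /L /=.
  have -> : differential f x =
      (fun v => \sum_i v 0 i * 'D_(e_ i) f x).
    by apply: funext => w; exact: differentialE.
  apply: (@Ck_continuous R n 0 setT) => //; apply: Ck_sum => // [|i _]; first exact: openT.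
  by apply: Ck_mul; [exact: openT|exact: Ck_coord|exact: Ck_cst].
apply: (is_diff_from_estimate (L := L) cL) => e e0.
(* The mean value estimate loses a factor n; n.+1 avoids dividing by zero. *)
pose e' := e / (n.+1%:R).
have e'0 : 0 < e' by rewrite divr_gt0.
have [r [r0 rU H]] := C1_ball oU Cf Ux e'0.
apply/nbhs_ballP; exists r => //= h; rewrite rV_ballE sub0r normrN => hr.
have Bx : ball x r x by exact: ballxx.
have Bhx : ball x r (h + x) by rewrite rV_ballE opprD addrCA subrr addr0 normrN.
have := mean_value_ball H Bx Bhx; rewrite addrK => le1.
have -> : L h = \sum_i 'D_(e_ i) f x * h 0 i.
  by rewrite /L /= differentialE; apply: eq_bigr => i _; rewrite mulrC.
apply: le_trans le1 _; rewrite mulrA ler_wpM2r// /e' -mulrA ler_piMr ?(ltW e0)//.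
by rewrite mulrC ler_pdivrMr ?ltr0Sn// mul1r ler_nat leqnSn.
Qed.

(** Along the line through x in the direction v, g is a curve, and a derivable curve
is differentiable; so only f has to be differentiable for the chain rule. *)
Lemma C1_chain n (V : set 'rV[R]_n) (W : normedModType R) (f : 'rV[R]_n -> R)
    (g : W -> 'rV[R]_n) (x v : W) (dg : 'I_n -> R) :
  open V -> Ck 1 V f -> V (g x) ->
  (forall j, is_derive x v (fun y => g y 0 j) (dg j)) ->
  is_derive x v (f \o g) (\sum_j dg j * 'D_(e_ j) f (g x)).
Proof.
move=> oV Cf Vgx dgj.
have dG : derivable g x v.
  by apply/derivable_mxP => i j; rewrite ord1; case: (dgj j).
pose c (h : R) := g (h *: v + x).
have dc : derivable c 0 1 := (derivable1P g x v).1 dG.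
have c0 : c 0 = g x by rewrite /c scale0r add0r.
have [dfc fcE] : is_diff (c 0) f (differential f (c 0)).
  by apply: C1_is_diff oV Cf _; rewrite c0.
have dc' : differentiable c 0 by exact/derivable1_diffP.
have dfg : derivable (f \o c) 0 1 by exact/derivable1_diffP/differentiable_comp.
have cE : 'd c 0 (1 : R) = 'D_v g x by rewrite (derive_line0 g) deriveE.
have DgE : 'D_v g x = \row_j dg j.
  apply/rowP => j; rewrite (derive_mx dG) [LHS]mxE [RHS]mxE.
  by case: (dgj j).
split; first exact: (derivable1P (f \o g) x v).2 dfg.
rewrite derive_line0 -/(f \o c) deriveE; last exact: differentiable_comp.
rewrite diff_comp //= fcE differentialE c0; apply: eq_bigr => j _; congr (_ * _).
by rewrite cE DgE mxE.
Qed.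

Lemma continuous_row (T : topologicalType) n (g : T -> 'rV[R]_n) x :
  (forall j, {for x, continuous (fun y => g y 0 j)}) -> {for x, continuous g}.
Proof.
move=> cg; apply/cvgrPdist_lt => e e0.
have H : \forall y \near x, forall j, `|g x 0 j - g y 0 j| < e.
  apply: (@filter_forall _ _ (fun j y => `|g x 0 j - g y 0 j| < e) (nbhs x) _) => j.
  by have /cvgrPdist_lt/(_ e e0) := cg j.
by apply: filterS H => y Hy; rewrite -rV_ballE; apply/rV_ballP.
Qed.

(** By the chain rule the partial derivatives of f o g are sums of products of
derivatives of g with (D_j f) o g, to which the induction hypothesis applies. *)
Lemma Ck_comp m n k (U : set 'rV[R]_m) (V : set 'rV[R]_n) f g :
  open U -> open V -> (forall x, U x -> V (g x)) ->
  (forall j, Ck k U (fun x => g x 0 j)) -> Ck k V f -> Ck k U (f \o g).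
Proof.
move=> oU oV gUV.
have contC l (F : 'rV[R]_n -> R) x : U x -> (forall j, Ck l U (fun x => g x 0 j)) ->
    Ck l V F -> {for x, continuous (F \o g)}.
  move=> Ux Cg CF; apply: continuous_comp (Ck_continuous CF (gUV _ Ux)).
  by apply: continuous_row => j; exact: Ck_continuous (Cg j) Ux.
elim: k f => [|k IH] f Cg Cf.
  by split=> // x /set_mem Ux; exact: contC Ux Cg Cf.
have Cf1 : Ck 1 V f.
  elim: {Cg IH contC} k Cf => // k IH Cf; apply: IH; exact: CkW.
have ch x i : U x -> is_derive x (e_ i) (f \o g)
    (\sum_j 'D_(e_ i) (fun x => g x 0 j) x * 'D_(e_ j) f (g x)).
  move=> Ux; apply: C1_chain oV Cf1 (gUV _ Ux) _ => j.
  by split=> //; exact: Ck_derivable (Cg j) Ux.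
apply: CkS_intro => [x Ux|x i Ux|i].
- exact: contC Ux Cg Cf.
- by case: (ch x i Ux).
- apply: (@Ck_eq R m k U (fun x =>
    \sum_j 'D_(e_ i) (fun x => g x 0 j) x * 'D_(e_ j) f (g x))) => //.
    by move=> x Ux; case: (ch x i Ux).
  apply: Ck_sum => // j _; apply: Ck_mul => //; first exact: Ck_derive.
  apply: (IH (fun y => 'D_(e_ j) f y)); last exact: Ck_derive.
  by move=> l; exact: CkW.
Qed.

Lemma smooth_comp m n (U : set 'rV[R]_m) (V : set 'rV[R]_n) f g :
  open U -> open V -> (forall x, U x -> V (g x)) ->
  vsmooth_on U g -> smooth_on V f -> smooth_on U (f \o g).
Proof.
move=> oU oV gUV sg sf k; apply: Ck_comp oU oV gUV _ (sf k) => j; exact: sg.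
Qed.

Lemma vsmooth_continuous m n (U : set 'rV[R]_m) (g : 'rV[R]_m -> 'rV[R]_n) x :
  vsmooth_on U g -> U x -> {for x, continuous g}.
Proof.
by move=> sg Ux; apply: continuous_row => j; exact: smooth_continuous (sg j) Ux.
Qed.

Lemma smooth_chain m n (U : set 'rV[R]_m) (V : set 'rV[R]_n) f g x i :
  open V -> smooth_on V f -> V (g x) -> vsmooth_on U g -> U x ->
  'D_(e_ i) (f \o g) x =
    \sum_j 'D_(e_ i) (fun x => g x 0 j) x * 'D_(e_ j) f (g x).
Proof.
move=> oV sf Vgx sg Ux.
suff [] : is_derive x (e_ i) (f \o g)
    (\sum_j 'D_(e_ i) (fun x => g x 0 j) x * 'D_(e_ j) f (g x)) by [].
apply: C1_chain oV (sf 1%N) Vgx _ => j.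
by split=> //; exact: smooth_derivable (sg j) Ux.
Qed.

Lemma smooth_cst n (U : set 'rV[R]_n) (a : R) : smooth_on U (fun=> a).
Proof. by move=> k; exact: Ck_cst. Qed.

Lemma smooth_coord n (U : set 'rV[R]_n) j : smooth_on U (fun x => x 0 j).
Proof. by move=> k; exact: Ck_coord. Qed.

Lemma smooth_add n (U : set 'rV[R]_n) f g : open U -> smooth_on U f ->
  smooth_on U g -> smooth_on U (fun x => f x + g x).
Proof. by move=> oU sf sg k; apply: Ck_add oU (sf k) (sg k). Qed.

Lemma smooth_mul n (U : set 'rV[R]_n) f g : open U -> smooth_on U f ->
  smooth_on U g -> smooth_on U (fun x => f x * g x).
Proof. by move=> oU sf sg k; apply: Ck_mul oU (sf k) (sg k). Qed.

Lemma smooth_sub n (U : set 'rV[R]_n) f g : open U -> smooth_on U f ->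
  smooth_on U g -> smooth_on U (fun x => f x - g x).
Proof.
move=> oU sf sg; apply: (smooth_eq (f := fun x => f x + (-1) * g x)) => //.
  by move=> x _; rewrite mulN1r.
by apply: smooth_add => //; apply: smooth_mul => //; exact: smooth_cst.
Qed.

Lemma smooth_inv n (U : set 'rV[R]_n) f : open U -> (forall x, U x -> f x != 0) ->
  smooth_on U f -> smooth_on U (fun x => (f x)^-1).
Proof. by move=> oU f0 sf k; apply: Ck_inv oU f0 (sf k). Qed.

Lemma smooth_sum n (U : set 'rV[R]_n) (I : Type) (r : seq I) (P : pred I)
    (F : I -> 'rV[R]_n -> R) : open U -> (forall i, P i -> smooth_on U (F i)) ->
  smooth_on U (fun x => \sum_(i <- r | P i) F i x).
Proof. by move=> oU sF k; apply: Ck_sum => // i Pi; exact: sF. Qed.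

Lemma smooth_prod n (U : set 'rV[R]_n) (I : Type) (r : seq I) (P : pred I)
    (F : I -> 'rV[R]_n -> R) : open U -> (forall i, P i -> smooth_on U (F i)) ->
  smooth_on U (fun x => \prod_(i <- r | P i) F i x).
Proof. by move=> oU sF k; apply: Ck_prod => // i Pi; exact: sF. Qed.

Lemma smooth_det n p (U : set 'rV[R]_n) (A : 'rV[R]_n -> 'M[R]_p) : open U ->
  (forall i j, smooth_on U (fun x => A x i j)) -> smooth_on U (fun x => \det (A x)).
Proof.
move=> oU sA; apply: smooth_sum => // s _; apply: smooth_mul => //.
  exact: smooth_cst.
by apply: smooth_prod => // i _; exact: sA.
Qed.

(** The entries of the inverse are cofactors divided by the determinant. *)
Lemma smooth_invmx n p (U : set 'rV[R]_n) (A : 'rV[R]_n -> 'M[R]_p) : open U ->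
  (forall x, U x -> A x \in unitmx) ->
  (forall i j, smooth_on U (fun x => A x i j)) ->
  forall i j, smooth_on U (fun x => invmx (A x) i j).
Proof.
move=> oU uA sA i j.
apply: (smooth_eq (f := fun x => (\det (A x))^-1 * cofactor (A x) j i)) => //.
  by move=> x Ux; rewrite /invmx uA // !mxE.
apply: smooth_mul => //.
  apply: smooth_inv => // [x Ux|]; last exact: smooth_det.
  by rewrite -unitfE -unitmxE uA.
apply: smooth_mul => //; first exact: smooth_cst.
apply: smooth_det => // k l; apply: smooth_eq (sA (lift j k) (lift i l)) => // x _.
by rewrite !mxE.
Qed.

End ChainRule.

(** * Smoothness through a local diffeomorphism *)

(* Joins completeness and the norm, as the contraction principle requires. *)
HB.instance Definition _ (R : realType) m n := Complete.on 'M[R]_(m, n).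

Section LocalInverse.
Context {R : realType}.
Implicit Types (m n k : nat).

Local Notation e_ i := (delta_mx 0 i).

(** Solve psi u = y as the fixed point of u + y - psi u, a contraction of the closed
ball of radius r/2: it moves u0 by less than r/4 and halves distances. *)
Lemma perturbed_identity_onto m (psi : 'rV[R]_m -> 'rV[R]_m) (u0 : 'rV[R]_m) (r : R) :
  0 < r ->
  (forall u v, ball u0 r u -> ball u0 r v ->
     `|(psi v - v) - (psi u - u)| <= 2^-1 * `|v - u|) ->
  forall y, ball (psi u0) (r / 4) y -> exists2 u, ball u0 r u & psi u = y.
Proof.
move=> r0 lip y By.
pose B : set 'rV[R]_m := closed_ball_ Num.norm u0 (r / 2).
have BB u : B u -> ball u0 r u.
  rewrite /B /closed_ball_ /= rV_ballE => h; apply: le_lt_trans h _; lra.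
have Bu0 : B u0 by rewrite /B /closed_ball_ /= subrr normr0; lra.
pose T u := u + y - psi u.
have TB : {homo T : u / B u >-> B u}.
  move=> u Bu; rewrite /B /closed_ball_ /= /T.
  have -> : u0 - (u + y - psi u) = (psi u0 - y) + ((psi u - u) - (psi u0 - u0)).
    by apply/rowP => j; rewrite !mxE; ring.
  apply: le_trans (ler_normD _ _) _.
  have h1 := lip u0 u (BB _ Bu0) (BB _ Bu).
  move: By; rewrite rV_ballE => h2; move: Bu; rewrite /B /closed_ball_ /= distrC => h3.
  lra.
have Tc : @is_contraction R 'rV[R]_m 'rV[R]_m B B (mkfun_fun TB).
  have h : (0 : R) <= 2^-1 by lra.
  exists (NngNum h); split => /=; first by lra.
  move=> [u v] /= [Bu Bv].
  have -> : T u - T v = (psi v - v) - (psi u - u).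
    by apply/rowP => j; rewrite !mxE; ring.
  by rewrite (distrC u v); apply: lip; exact: BB.
have [|p Bp pE] := @banach_fixed_point R 'rV[R]_m B (mkfun_fun TB) Tc
  (@closed_closed_ball_ R 'rV[R]_m u0 (r / 2)); first by exists u0.
exists p; first exact: BB.
move: pE; rewrite /= /T => /rowP pE; apply/rowP => j; have := pE j.
by rewrite !mxE => ?; lra.
Qed.

(** Row i holds the derivatives in the direction i, so that the differential is the map
v |-> v J on row vectors. *)
Definition jac m n (psi : 'rV[R]_m -> 'rV[R]_n) (u : 'rV[R]_m) : 'M[R]_(m, n) :=
  \matrix_(i, j) 'D_(e_ i) (fun x => psi x 0 j) u.

Lemma smooth_jac m n (U : set 'rV[R]_m) (psi : 'rV[R]_m -> 'rV[R]_n) i j :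
  open U -> vsmooth_on U psi -> smooth_on U (fun u => jac psi u i j).
Proof.
move=> oU sp; apply: smooth_eq (smooth_derive i (sp j)) => // x _.
by rewrite mxE.
Qed.

(** By continuity of the Jacobian and of its determinant.  Entries within 1/(2(m+1)) of
those of the identity bound the increments of psi - id by half the distance. *)
Lemma near_identity_ball m (U : set 'rV[R]_m) (psi : 'rV[R]_m -> 'rV[R]_m) u0 :
  open U -> U u0 -> vsmooth_on U psi -> jac psi u0 = 1%:M ->
  exists r : R, [/\ 0 < r, ball u0 r `<=` U,
    forall u, ball u0 r u -> jac psi u \in unitmx &
    forall u v, ball u0 r u -> ball u0 r v ->
     `|(psi v - v) - (psi u - u)| <= 2^-1 * `|v - u|].
Proof.
move=> oU Uu0 sp J1.
pose e : R := (2 * m.+1%:R)^-1.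
have e0 : 0 < e by rewrite invr_gt0 mulr_gt0.
have cdet : {for u0, continuous (fun u => \det (jac psi u))}.
  apply: smooth_continuous Uu0; apply: smooth_det => // i j; exact: smooth_jac.
have near_det : \forall u \near u0, \det (jac psi u) != 0.
  have /cvgrPdist_lt/(_ 1 ltr01) := cdet; rewrite J1 det1; apply: filterS => u.
  by apply: contraTneq => ->; rewrite subr0 normr1 ltxx.
have near_jac : \forall u \near u0, forall ij : ('I_m * 'I_m)%type,
    `|jac psi u ij.1 ij.2 - (1%:M : 'M[R]_m) ij.1 ij.2| <= e.
  apply: (@filter_forall _ _ (fun ij u =>
    `|jac psi u ij.1 ij.2 - (1%:M : 'M[R]_m) ij.1 ij.2| <= e) (nbhs u0) _) => -[i j] /=.
  have /cvgrPdist_le/(_ e e0) := smooth_continuous (smooth_jac i j oU sp) Uu0.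
  by apply: filterS => u; rewrite J1 distrC.
have near_U : \forall u \near u0, U u by exact: open_nbhs_nbhs.
have [r r0 H] := near_ballP (filterI near_U (filterI near_det near_jac)).
exists r; split => // [u /H[]//|u /H[_ [+ _]]|u v Bu Bv].
  by rewrite unitmxE unitfE.
apply: rV_norm_le => [|j]; first by rewrite mulr_ge0 // invr_ge0.
have Hj x : ball u0 r x -> forall i, derivable (fun x => psi x 0 j) x (e_ i) /\
    `|'D_(e_ i) (fun x => psi x 0 j) x - (i == j)%:R| <= e.
  move=> Bx i; have [Ux [_ /(_ (i, j)) /=]] := H x Bx; rewrite !mxE => Jx.
  by split=> //; exact: smooth_derivable (sp j) Ux.
have := mean_value_ball Hj Bu Bv.
have -> : \sum_i (i == j)%:R * (v - u) 0 i = (v - u) 0 j.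
  rewrite (bigD1 j) //= eqxx mul1r big1 ?addr0 // => i /negPf ->.
  by rewrite mul0r.
have -> : psi v 0 j - psi u 0 j - (v - u) 0 j = (psi v - v - (psi u - u)) 0 j.
  by rewrite !mxE; ring.
move=> h; apply: le_trans h _; rewrite mulrA ler_wpM2r //.
rewrite /e invfM -mulrA ler_piMr ?invr_ge0 //.
by rewrite mulrC ler_pdivrMr ?ltr0Sn // mul1r ler_nat leqnSn.
Qed.

(** Let chi be the inverse of psi on V, which is Lipschitz, and H = kappa
o psi.  Then D_j kappa exists and equals c_j o chi, where c = J^-1 grad H and J is
the Jacobian of psi; as c_j is smooth and (D_j kappa) o psi = c_j, induction on the
order of differentiability applies to D_j kappa. *)
Lemma smooth_descent m (U : set 'rV[R]_m) (psi : 'rV[R]_m -> 'rV[R]_m) u0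
    (kappa : 'rV[R]_m -> R) :
  open U -> U u0 -> vsmooth_on U psi -> jac psi u0 = 1%:M ->
  smooth_on U (kappa \o psi) ->
  exists V, [/\ open V, V (psi u0) & smooth_on V kappa].
Proof.
move=> oU Uu0 sp J1 skp.
have [r [r0 BU uJ lip]] := near_identity_ball oU Uu0 sp J1.
pose V := ball (psi u0) (r / 4); pose B := [set u | ball u0 r u /\ V (psi u)].
have oV : open V by exact: ball_open.
have oB : open B.
  rewrite openE => u [Bu Vu].
  have spu : {for u, continuous psi} by exact: vsmooth_continuous sp (BU _ Bu).
  have nB : \forall v \near u, ball u0 r v.
    by apply: open_nbhs_nbhs; split=> //; exact: ball_open.
  have nV : \forall v \near u, V (psi v) by apply: spu; exact: open_nbhs_nbhs.
  exact: filterI nB nV.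
have onto := perturbed_identity_onto r0 lip.
have /choice[chi chiP] : forall y, exists u, V y -> B u /\ psi u = y.
  move=> y; have [Vy|nV] := pselect (V y); last by exists u0.
  by have [u Bu uy] := onto y Vy; exists u => _; rewrite /B /= uy.
have expand u v : B u -> B v -> `|v - u| <= 2 * `|psi v - psi u|.
  move=> [Bu _] [Bv _]; have := lip _ _ Bu Bv.
  have := ler_normB (psi v - psi u) (psi v - v - (psi u - u)).
  have -> : psi v - psi u - (psi v - v - (psi u - u)) = v - u.
    by apply/rowP => j; rewrite !mxE; ring.
  lra.
have chiL y y' : V y -> V y' -> `|chi y' - chi y| <= 2 * `|y' - y|.
  by move=> /chiP[Bu uy] /chiP[Bv vy]; have := expand _ _ Bu Bv; rewrite uy vy.
have chiK u : B u -> chi (psi u) = u.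
  move=> Bu; have [Bv vu] := chiP _ Bu.2; have := expand _ _ Bu Bv.
  by rewrite vu subrr normr0 mulr0 normr_le0 subr_eq0 => /eqP.
have near_chi y (P : 'rV[R]_m -> Prop) : V y -> (\forall u \near chi y, P u) ->
    \forall y' \near y, V y' /\ P (chi y').
  move=> Vy /near_ballP[d d0 dP].
  have nV : \forall y' \near y, V y' by exact: open_nbhs_nbhs.
  have nd : \forall y' \near y, ball y (d / 2) y'.
    by apply: nbhsx_ballx; rewrite divr_gt0.
  apply: (near_mono2 _ nV nd) => y' Vy'; rewrite rV_ballE distrC => yy'.
  split=> //; apply: dP; rewrite rV_ballE distrC.
  by apply: le_lt_trans (chiL _ _ Vy Vy') _; lra.
exists V; split; [by []|exact: ballxx (divr_gt0 r0 _)|].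
have skpB : smooth_on B (kappa \o psi) by apply: smooth_subset skp => u [/BU].
have spB : vsmooth_on B psi by move=> j; apply: smooth_subset (sp j) => u [/BU].
have cont (f : 'rV[R]_m -> R) y : smooth_on B (f \o psi) -> V y ->
    {for y, continuous f}.
  move=> sf Vy; apply: continuous_dist => e e0; have [Bu uy] := chiP y Vy.
  have /cvgrPdist_lt/(_ e e0) := smooth_continuous sf Bu.
  move=> /(near_chi y _ Vy); apply: near_mono => y' [/chiP[_ uy']] /=.
  by rewrite uy uy'.
move=> k {skp}; elim: k kappa skpB => [|k IH] kappa skpB.
  by split=> // y /set_mem; exact: cont.
pose H u := kappa (psi u).
pose c u j := (invmx (jac psi u) *m grad H u) j 0.
have sc j : smooth_on B (c ^~ j).
  apply: (smooth_eq (f := fun u => \sum_i invmx (jac psi u) j i * 'D_(e_ i) H u)) => //.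
    by move=> u _; rewrite /c mxE; apply: eq_bigr => i _; rewrite [grad _ _ _ _]mxE.
  apply: smooth_sum => // i _; apply: smooth_mul => //; last exact: smooth_derive.
  apply: smooth_invmx => // [v [/uJ]//|p q]; exact: smooth_jac.
(* Subtracting sum_l c_l psi_l, with c frozen at u = chi y, kills the gradient of H at u.
   The increment of the difference from u to chi y' is therefore o(|chi y' - u|), hence
   o(|y' - y|), and it equals kappa y' - kappa y - h c_j when y' = y + h e_j. *)
have dk y j : V y -> is_derive y (e_ j) kappa (c (chi y) j).
  move=> Vy; have [Bu uy] := chiP y Vy.
  pose u := chi y; rewrite -/u in Bu uy *.
  pose Th v := H v - \sum_l c u l * psi v 0 l.
  have sTh : smooth_on B Th.
    apply: smooth_sub => //; apply: smooth_sum => // l _; apply: smooth_mul => //.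
    exact: smooth_cst.
  have dTh i : 'D_(e_ i) Th u = 0.
    have d1 : is_derive u (e_ i) H ('D_(e_ i) H u).
      by split=> //; exact: smooth_derivable skpB Bu.
    have d2 : is_derive u (e_ i) (fun v => \sum_l c u l * psi v 0 l)
        (\sum_l c u l * jac psi u i l).
      apply: is_derive_sumfun => l; rewrite [jac _ _ _ _]mxE.
      have dl : is_derive u (e_ i) (fun x => psi x 0 l) ('D_(e_ i) (fun x => psi x 0 l) u).
        by split=> //; exact: smooth_derivable (spB l) Bu.
      exact: (@is_deriveZ _ _ _ (fun x => psi x 0 l) (c u l) u (e_ i)).
    have [_ ->] := is_deriveB d1 d2.
    have : jac psi u *m (invmx (jac psi u) *m grad H u) = grad H u.
      by rewrite mulmxA mulmxV ?mul1mx //; exact: (uJ u (proj1 Bu)).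
    move=> /colP/(_ i); rewrite mxE [RHS]mxE => <-; apply/eqP; rewrite subr_eq0.
    by apply/eqP; apply: eq_bigr => l _; rewrite mulrC.
  suff lim_k : h^-1 *: ((kappa \o shift y) (h *: e_ j) - kappa y) @[h --> 0^'] --> c u j.
    by split; [apply/cvg_ex; exists (c u j)|exact: cvg_lim lim_k].
  apply/cvgrPdist_le => e e0.
  pose e' := e / (2 * m.+1%:R).
  have e'0 : 0 < e' by rewrite divr_gt0 // mulr_gt0.
  have [r' [r'0 _ HTh]] := C1_ball oB (sTh 1%N) Bu e'0.
  have nu : \forall v \near chi y, ball u r' v by exact: nbhsx_ballx.
  have [d d0 dP] := near_ballP (near_chi y _ Vy nu).
  have nh0 : \forall h \near (0 : R)^', h != 0 by exact: nbhs_dnbhs_neq.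
  have nhd : \forall h \near (0 : R)^', `|h| < d by exact: dnbhs0_lt.
  apply: filterS (filterI nh0 nhd) => h [h0 hd].
  pose y' := h *: (e_ j : 'rV[R]_m) + y; rewrite /= -/y'.
  have yy' : `|y' - y| <= `|h| by rewrite /y' addrK norm_scale_delta.
  have [Vy' Bv] : V y' /\ ball u r' (chi y').
    by apply: dP; rewrite rV_ballE distrC; apply: le_lt_trans yy' hd.
  have Bu' : ball u r' u by exact: ballxx.
  have := mean_value_ball HTh Bu' Bv.
  have [_ vy'] := chiP y' Vy'.
  rewrite big1 => [|i _]; last by rewrite dTh mul0r.
  have -> : Th (chi y') - Th u - 0 = kappa y' - kappa y - h * c u j.
    rewrite subr0 /Th /H vy' uy.
    suff -> : \sum_l c u l * y' 0 l = \sum_l c u l * y 0 l + h * c u j by ring.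
    rewrite /y' (bigD1 j) //= [in RHS](bigD1 j) //= !mxE !eqxx mulr1 mulrDr.
    rewrite (eq_bigr (fun l => c u l * y 0 l)); first by ring.
    by move=> l lj; rewrite !mxE eqxx (negPf lj) mulr0 add0r.
  move=> hTh; rewrite distrC.
  have -> : h^-1 *: (kappa y' - kappa y) - c u j =
      h^-1 * (kappa y' - kappa y - h * c u j).
    by rewrite mulrBr mulKf.
  rewrite normrM normfV ler_pdivrMl ?normr_gt0 // [leRHS]mulrC.
  apply: le_trans hTh _.
  have h1 : `|chi y' - u| <= 2 * `|h|.
    by apply: le_trans (chiL _ _ Vy Vy') _; rewrite ler_pM2l.
  have h2 : m%:R * `|chi y' - u| <= m.+1%:R * (2 * `|h|).
    by apply: ler_pM => //; rewrite ler_nat leqnSn.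
  apply: le_trans (ler_wpM2l (ltW e'0) h2) _.
  have : (m.+1%:R : R) != 0 by rewrite pnatr_eq0.
  rewrite /e'; move: (m.+1%:R : R) => M M0.
  by rewrite le_eqVlt; apply/orP; left; apply/eqP; field.
apply: CkS_intro => [y Vy|y j Vy|j].
- exact: cont skpB Vy.
- by case: (dk y j Vy).
- apply: (IH (fun y => 'D_(e_ j) kappa y)).
  apply: smooth_eq (sc j) => // u Bu.
  by have [_ /= ->] := dk _ j Bu.2; rewrite chiK.
Qed.

End LocalInverse.

(** * Bump functions *)

Section Bump.
Context {R : realType}.
Implicit Types (m n k : nat).

Local Notation e_ i := (delta_mx 0 i).

(** The functions t^-k exp(-1/t), flat at 0: derivatives of exp(-1/t) are linear
combinations of them, so the family is closed under differentiation. *)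
Definition flat k (t : R) : R := if 0 < t then t^-1 ^+ k * expR (- t^-1) else 0.

Lemma flat_gt0 k t : 0 < t -> 0 < flat k t.
Proof. by move=> t0; rewrite /flat t0 mulr_gt0 ?expR_gt0 // exprn_gt0 // invr_gt0. Qed.

Lemma flat_le0 k t : t <= 0 -> flat k t = 0.
Proof. by move=> t0; rewrite /flat ltNge t0. Qed.

(** Linear decay at 0 gives continuity there, and, for k+1 in place of k, a zero
derivative.  It comes from s^(k+1) / (k+1)! <= exp s at s = 1/t. *)
Lemma flat_bound k t : `|flat k t| <= (k.+1)`!%:R * `|t|.
Proof.
have [t0|t0] := ltP 0 t; last by rewrite flat_le0 // normr0 mulr_ge0.
rewrite (gtr0_norm (flat_gt0 k t0)) (gtr0_norm t0) /flat t0.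
pose s := t^-1; have s0 : 0 < s by rewrite invr_gt0.
have := expR_ge1Dxn k (ltW s0); rewrite -/s expRN => h.
rewrite ler_pdivrMr ?expR_gt0 //.
have c0 : 0 < (k.+1)`!%:R :> R by rewrite ltr0n fact_gt0.
have h2 : s ^+ k.+1 <= (k.+1)`!%:R * expR s.
  by rewrite mulrC -ler_pdivrMr //; apply: le_trans h; rewrite lerDr.
have -> : s ^+ k = s ^+ k.+1 * t by rewrite exprSr -mulrA mulVf ?mulr1 // gt_eqF.
by rewrite mulrAC ler_pM2r.
Qed.

Lemma is_derive_flat k (t : R) :
  is_derive t 1 (flat k) (- k%:R * flat k.+1 t + flat k.+2 t).
Proof.
have [t0|t0|t0] := ltgtP 0 t.
- pose f (s : R) := s^-1 ^+ k * expR (- s^-1).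
  have near_f : \forall s \near t, f s = flat k s.
    by apply: near_mono (lt_nbhsr t0) => s s0; rewrite /flat s0.
  apply: (@near_eq_is_derive R R R f (flat k) t 1 _ near_f).
  have tn0 : t != 0 by rewrite gt_eqF.
  have dV : is_derive t 1 (fun s : R => s^-1) (- t ^- 2).
    have [d1 d2] := @is_derive_id R R t 1.
    split; first exact: (@derivableV _ _ id).
    by rewrite (@deriveV _ _ id) // d2 /GRing.scale /= mulr1.
  have dX : is_derive t 1 (fun s : R => s^-1 ^+ k) (k%:R * t^-1 ^+ k.-1 * - t ^- 2).
    have -> : (fun s : R => s^-1 ^+ k) = (fun s : R => s^-1) ^+ k.
      by rewrite exprfctE.
    exact: is_deriveX.
  have dE : is_derive t 1 (fun s : R => expR (- s^-1)) (expR (- t^-1) * t ^- 2).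
    apply: is_derive_eq (@is_derive1_comp _ expR (fun s : R => - s^-1) t _ _ _ (is_deriveN dV)) _.
    by rewrite opprK.
  apply: is_derive_eq (is_deriveM dX dE) _.
  rewrite /GRing.scale /= /flat t0 -exprVn expr2 !exprS.
  case: k {near_f dX f} => [|k]; first by rewrite /=; ring.
  by rewrite /= !exprS; ring.
- have near_f : \forall s \near t, (cst 0 : R -> R) s = flat k s.
    by apply: near_mono (lt_nbhsl t0) => s s0; rewrite flat_le0 // ltW.
  apply: (@near_eq_is_derive R R R (cst 0) (flat k) t 1 _ near_f).
  by apply: is_derive_eq; rewrite !flat_le0 ?(ltW t0) // mulr0 addr0.
rewrite -t0 !(@flat_le0 _ 0) // mulr0 addr0.
suff lim0 : h^-1 *: ((flat k \o shift 0) (h *: 1) - flat k 0) @[h --> 0^'] --> (0 : R).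
  by split; [apply/cvg_ex; exists 0|exact: cvg_lim lim0].
apply/cvgrPdist_lt => e e0.
pose c : R := (k.+2)`!%:R; have c0 : 0 < c by rewrite ltr0n fact_gt0.
have nhd : \forall h \near (0 : R)^', `|h| < e / c by apply: dnbhs0_lt; rewrite divr_gt0.
have nh0 : \forall h \near (0 : R)^', h != 0 by exact: nbhs_dnbhs_neq.
apply: filterS2 nh0 nhd => h h0 hd /=.
rewrite sub0r normrN addr0 [h *: 1]mulr1 (@flat_le0 k 0) // subr0.
apply: (@le_lt_trans _ _ `|flat k.+1 h|); last first.
  apply: le_lt_trans (flat_bound _ _) _.
  by rewrite mulrC -ltr_pdivlMr.
rewrite /flat; case: ifP => // _; last by rewrite scaler0.
by rewrite /GRing.scale /= exprS mulrA.
Qed.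

Lemma is_derive_comp_line (W : normedModType R) (phi : R -> R) (q : W -> R) x v a b :
  is_derive (q x) 1 phi a -> is_derive x v q b -> is_derive x v (phi \o q) (a * b).
Proof.
move=> dphi [dq <-].
have dc : derivable (fun h : R => q (h *: v + x)) 0 1 := (derivable1P q x v).1 dq.
have c0 : q (0 *: v + x) = q x by rewrite scale0r add0r.
have [d1 d2] : is_derive (0 : R) 1 (phi \o (fun h : R => q (h *: v + x))) (a * 'D_v q x).
  apply: is_derive1_comp; first by rewrite c0.
  by split=> //; rewrite -derive_line0.
split; first exact: (derivable1P (phi \o q) x v).2 d1.
by rewrite derive_line0.
Qed.

Lemma flat_smooth n (U : set 'rV[R]_n) (q : 'rV[R]_n -> R) k : open U ->
  smooth_on U q -> smooth_on U (flat k \o q).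
Proof.
move=> oU sq l; elim: l k => [|l IH] k.
  split=> // x /set_mem Ux; apply: continuous_comp (smooth_continuous sq Ux) _.
  apply: differentiable_continuous; apply/derivable1_diffP.
  by case: (is_derive_flat k (q x)).
have d x i : U x -> is_derive x (e_ i) (flat k \o q)
    ((- k%:R * flat k.+1 (q x) + flat k.+2 (q x)) * 'D_(e_ i) q x).
  move=> Ux; apply: is_derive_comp_line (is_derive_flat k (q x)) _.
  by split=> //; exact: smooth_derivable sq Ux.
apply: CkS_intro => [x Ux|x i Ux|i].
- have := IH k; case: l {IH} => [|l] C; exact: (Ck_continuous C Ux).
- by case: (d x i Ux).
- apply: (@Ck_eq R n l U (fun x =>
    (- k%:R * flat k.+1 (q x) + flat k.+2 (q x)) * 'D_(e_ i) q x)) => //.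
    by move=> x Ux; case: (d x i Ux).
  apply: Ck_mul => //; last exact: smooth_derive.
  apply: Ck_add => //; last exact: IH.
  by apply: Ck_mul => //; [exact: Ck_cst|exact: IH].
Qed.

(** The product over the coordinates of exp(-1 / (r^2 - (y_j - y0_j)^2)), extended by
zero.  A ball of the sup norm is a cube, hence the product. *)
Lemma bump_exists n (y0 : 'rV[R]_n) (r : R) : 0 < r ->
  exists b : 'rV[R]_n -> R, [/\ smooth_on setT b, (forall y, ball y0 r y -> 0 < b y) &
    forall y, ~ ball y0 r y -> b y = 0].
Proof.
move=> r0; exists (fun y => \prod_j flat 0 (r ^+ 2 - (y 0 j - y0 0 j) ^+ 2)); split.
- apply: smooth_prod => [|j _]; first exact: openT.
  apply: (@flat_smooth _ _ (fun y => r ^+ 2 - (y 0 j - y0 0 j) ^+ 2)); first exact: openT.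
  apply: smooth_sub; [exact: openT|exact: smooth_cst|].
  apply: (smooth_mul (f := fun y => y 0 j - y0 0 j)); first exact: openT.
    by apply: smooth_sub; [exact: openT|exact: smooth_coord|exact: smooth_cst].
  by apply: smooth_sub; [exact: openT|exact: smooth_coord|exact: smooth_cst].
- move=> y /rV_ballP[_ H]; apply: prodr_gt0 => j _; apply: flat_gt0.
  rewrite subr_gt0 -[ltLHS]real_normK ?num_real // ltr_pXn2r ?nnegrE ?(ltW r0) //.
  by rewrite distrC.
- move=> y nB; apply/eqP/prodf_eq0.
  have [j Hj] : exists j, ~ (`|y0 0 j - y 0 j| < r).
    by apply/existsNP => H; apply: nB; apply/rV_ballP.
  exists j => //; rewrite flat_le0 // subr_le0 -[leRHS]real_normK ?num_real //.
  rewrite ler_pXn2r ?nnegrE ?(ltW r0) // distrC leNgt.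
  by apply/negP.
Qed.

End Bump.

(** * Integrals over the unit interval *)

Local Notation "'I01' f" :=
  (\int[lebesgue_measure]_(t in `[0%R, 1%R]) f t) (at level 10, f at level 9).

Section Integral01.
Context {R : realType}.

Definition cont01 (f : R -> R) := {within `[0, 1], continuous f}.

Lemma cont01P (f : R -> R) : (forall t : R, 0 <= t <= 1 -> {for t, continuous f}) ->
  cont01 f.
Proof.
move=> cf; apply: continuous_in_subspaceT => t /set_mem /=.
by rewrite in_itv /= => /cf.
Qed.

Lemma cont01_integrable f : cont01 f -> lebesgue_measure.-integrable `[0, 1] (EFin \o f).
Proof. by move=> cf; apply: continuous_compact_integrable => //; exact: segment_compact. Qed.

Lemma integral01_cst (M : R) : I01 (fun=> M) = M.
Proof.
rewrite Rintegral_cst; last exact: measurable_itv.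
have X := lebesgue_measure_itv `[0 : R, 1]; rewrite /= lte_fin ltr01 oppr0 adde0 in X.
have -> : fine (lebesgue_measure `[0 : R, 1]) = fine (1%:E : \bar R) := congr1 fine X.
by rewrite mulr1.
Qed.

Lemma integral01_bound f (M : R) : cont01 f -> (forall t : R, 0 <= t <= 1 -> `|f t| <= M) ->
  `|I01 f| <= M.
Proof.
move=> cf fM.
apply: (le_trans (le_normr_Rintegral _ (cont01_integrable cf))); first exact: measurable_itv.
rewrite -[leRHS]integral01_cst.
apply: le_Rintegral => //.
- apply: (cont01_integrable (f := fun t => `|f t|)) => t; apply: continuous_comp; first exact: cf.
  exact: norm_continuous.
- by apply: (cont01_integrable (f := fun=> M)) => t; exact: cst_continuous.
Qed.

Lemma integral01B f g : cont01 f -> cont01 g ->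
  I01 (fun t => f t - g t) = I01 f - I01 g.
Proof.
move=> cf cg; apply: RintegralB; [exact: measurable_itv|exact: cont01_integrable..].
Qed.

Lemma integral01Z f (a : R) : cont01 f -> I01 (fun t => a * f t) = a * I01 f.
Proof.
move=> cf; apply: RintegralZl; [exact: measurable_itv|exact: cont01_integrable].
Qed.

Lemma cont01_sub f g : cont01 f -> cont01 g -> cont01 (fun t => f t - g t).
Proof. by move=> cf cg t; exact: cvgB (cf t) (cg t). Qed.

Lemma cont01_scale f (a : R) : cont01 f -> cont01 (fun t => a * f t).
Proof. by move=> cf t; exact: cvgM (cvg_cst _) (cf t). Qed.

Lemma integral01_sum (I : finType) (f : I -> R -> R) : (forall i, cont01 (f i)) ->
  cont01 (fun t => \sum_i f i t) /\
  I01 (fun t => \sum_i f i t) = \sum_i I01 (f i).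
Proof.
move=> cf; elim: (index_enum I) => [|i s [IHc IH]].
  have -> : (fun t => \sum_(i <- [::]) f i t) = (fun=> 0).
    by apply: funext => t; rewrite big_nil.
  rewrite big_nil; split; first by move=> t; exact: cst_continuous.
  exact: integral01_cst.
have -> : (fun t => \sum_(j <- i :: s) f j t) =
    (fun t => f i t + \sum_(j <- s) f j t).
  by apply: funext => t; rewrite big_cons.
split; first by move=> t; exact: cvgD (cf i t) (IHc t).
rewrite big_cons -IH; apply: RintegralD; first exact: measurable_itv.
  exact: cont01_integrable.
exact: cont01_integrable.
Qed.

(** Derivability on the closed interval, as a two-sided derivative, spares one-sided
limits to the users. *)
Lemma integral01_FTC (F f : R -> R) : (forall t : R, 0 <= t <= 1 -> is_derive t 1 F (f t)) ->
  cont01 f -> I01 f = F 1 - F 0.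
Proof.
move=> dF cf; rewrite /Rintegral (@continuous_FTC2 R f F 0 1) //.
  have cF (t : R) : 0 <= t <= 1 -> {for t, continuous F}.
    move=> /dF[d _]; apply: differentiable_continuous; exact/derivable1_diffP.
  split=> [t|/=|/=].
  - by rewrite in_itv /= => /andP[/ltW t0 /ltW t1]; case: (dF t); rewrite ?t0.
  - by apply: cvg_at_right_filter; apply: cF; rewrite lexx ler01.
  - by apply: cvg_at_left_filter; apply: cF; rewrite lexx ler01.
move=> t; rewrite in_itv /= => /andP[/ltW t0 /ltW t1].
by rewrite derive1E; case: (dF t); rewrite ?t0.
Qed.

End Integral01.

Arguments cont01_scale {R} [f] a _ : rename.

(** * Boundedness and Lipschitz estimates on smaller balls *)

Section LocalBounds.
Context {R : realType} (n : nat).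

Local Notation e_ i := (delta_mx 0 i).

Lemma closed_ball_compact (c : 'rV[R]_n) (s : R) :
  compact (closed_ball_ Num.norm c s : set 'rV[R]_n).
Proof.
apply: bounded_closed_compact; last exact: closed_closed_ball_.
exists (s + `|c|); split; first exact: num_real.
move=> M ltM y; rewrite /closed_ball_ /= => h.
have := ler_normB c (c - y); rewrite subKr; lra.
Qed.

Context (x0 : 'rV[R]_n) (r rho : R).
Hypothesis rho0 : 0 < rho.
Hypothesis rho_r : rho < r.

Local Notation B := (ball x0 r).
Local Notation B' := (ball x0 rho).

Lemma ball_rho_sub x : B' x -> B x.
Proof. by rewrite !rV_ballE => h; apply: lt_trans rho_r. Qed.

Lemma smooth_bounded f : smooth_on B f -> exists K : R, forall y, B' y -> `|f y| <= K.
Proof.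
move=> sf; pose A : set 'rV[R]_n := closed_ball_ Num.norm x0 rho.
have AB y : A y -> B y by rewrite /A /closed_ball_ /= rV_ballE => h; apply: le_lt_trans rho_r.
have cA : compact A by exact: closed_ball_compact.
have cf : {within A, continuous f}.
  apply: continuous_in_subspaceT => y /set_mem /AB; exact: smooth_continuous.
have [M [_ HM]] := compact_bounded (continuous_compact cf cA).
exists (M + 1) => y; rewrite rV_ballE => By; apply: HM; first by rewrite ltrDl.
by exists y => //; rewrite /A /closed_ball_ /= ltW.
Qed.

Lemma smooth_lipschitz f : smooth_on B f ->
  exists L : R, 0 <= L /\ forall x y, B' x -> B' y -> `|f y - f x| <= L * `|y - x|.
Proof.
move=> sf.
have /choice[K HK] : forall i, exists K : R, forall y, B' y -> `|'D_(e_ i) f y| <= K.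
  by move=> i; apply: smooth_bounded; exact: smooth_derive.
have K0 i : 0 <= K i by apply: le_trans (HK i x0 (ballxx _ rho0)).
exists ((\sum_i K i) * n%:R); split; first by rewrite mulr_ge0 // sumr_ge0.
move=> x y Bx By.
have H z : B' z -> forall i, derivable f z (e_ i) /\
    `|'D_(e_ i) f z - (fun=> 0) i| <= \sum_i K i.
  move=> Bz i; split; first exact: smooth_derivable sf (ball_rho_sub Bz).
  by rewrite subr0 (bigD1 i) //= (le_trans (HK i z Bz)) // lerDl sumr_ge0.
have := mean_value_ball H Bx By.
by rewrite big1 ?subr0 ?mulrA // => i _; rewrite mul0r.
Qed.

End LocalBounds.

(** * Hadamard's lemma *)

Section Hadamard.
Context {R : realType} (n : nat) (x0 : 'rV[R]_n) (r rho : R).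
Hypothesis rho0 : 0 < rho.
Hypothesis rho_r : rho < r.

Local Notation e_ i := (delta_mx 0 i).
Local Notation B := (ball x0 r).
Local Notation B' := (ball x0 rho).

Definition ray (x : 'rV[R]_n) (t : R) := t *: (x - x0) + x0.

Lemma norm_ray x (t : R) : 0 <= t <= 1 -> `|x0 - ray x t| <= `|x0 - x|.
Proof.
move=> /andP[t0 t1]; rewrite /ray opprD addrCA subrr addr0 normrN normrZ ger0_norm //.
by rewrite (distrC x0) ler_piMl.
Qed.

Lemma ray_in_ball x (t : R) : B' x -> 0 <= t <= 1 -> B' (ray x t).
Proof. by rewrite !rV_ballE => h t01; apply: le_lt_trans (norm_ray x t01) h. Qed.

(** The weights t^a appear because differentiating Phi (x0 + t (x - x0)) in x produces
a factor t: the family is closed under partial derivatives. *)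
Definition ray_integral a (Phi : 'rV[R]_n -> R) x := I01 (fun t => t ^+ a * Phi (ray x t)).

Lemma is_derive_ray x (t : R) j :
  is_derive t 1 (fun s : R => ray x s 0 j) ((x - x0) 0 j).
Proof.
have [d E] := is_derive_coord (t *: (x - x0) + x0) (x - x0) j.
by have := derivable_line d; rewrite E.
Qed.

Lemma ray_continuous x : continuous (ray x).
Proof.
move=> t; apply: continuous_row => j.
by apply: differentiable_continuous; apply/derivable1_diffP; case: (is_derive_ray x t j).
Qed.

Lemma ray_integral_cont a Phi x : smooth_on B Phi -> B' x ->
  cont01 (fun t => t ^+ a * Phi (ray x t)).
Proof.
move=> sP Bx; apply: cont01P => t t01; apply: cvgM; first exact: exprn_continuous.
apply: continuous_comp; first exact: ray_continuous.
by apply: smooth_continuous sP _; apply: (ball_rho_sub rho_r); exact: ray_in_ball.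
Qed.

Lemma ray_integral_continuous a Phi x : smooth_on B Phi -> B' x ->
  {for x, continuous (ray_integral a Phi)}.
Proof.
move=> sP Bx; have [L [L0 HL]] := smooth_lipschitz rho0 rho_r sP.
apply: continuous_dist => e e0.
have oB' : open B' by exact: ball_open.
have nB : \forall y \near x, B' y by exact: open_nbhs_nbhs.
have nd : \forall y \near x, ball x (e / (L + 1)) y.
  by apply: nbhsx_ballx; rewrite divr_gt0 // ltr_wpDl.
apply: (near_mono2 _ nB nd) => y By; rewrite rV_ballE => xy.
rewrite /ray_integral -integral01B; [|exact: ray_integral_cont..].
apply: (@le_lt_trans _ _ (L * `|x - y|)); last first.
  move: xy; rewrite ltr_pdivlMr ?ltr_wpDl // mulrDr mulr1 => h.
  by rewrite mulrC; apply: le_lt_trans h; rewrite lerDl.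
apply: integral01_bound => [|t t01]; first by apply: cont01_sub; exact: ray_integral_cont.
have /andP[t0 t1] := t01.
rewrite -mulrBr normrM ger0_norm ?exprn_ge0 // -[leRHS]mul1r.
apply: ler_pM => //; rewrite ?exprn_ge0 ?exprn_ile1 //.
apply: le_trans (HL _ _ (ray_in_ball By t01) (ray_in_ball Bx t01)) _.
rewrite ler_wpM2l // /ray opprD addrACA subrr addr0 -scalerBr opprB addrA subrK.
by rewrite normrZ ger0_norm // ler_piMl.
Qed.

(** The error of the first-order expansion of Phi at the point ray x t, for the
increment t h e_i, is at most K h^2 uniformly in t, where K is a Lipschitz constant
of D_i Phi.  Integrating over t keeps the bound. *)
Lemma ray_integral_derive a Phi x i : smooth_on B Phi -> B' x ->
  is_derive x (e_ i) (ray_integral a Phi) (ray_integral a.+1 (fun y => 'D_(e_ i) Phi y) x).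
Proof.
move=> sP Bx; have sD := smooth_derive i sP.
have [K [K0 HK]] := smooth_lipschitz rho0 rho_r sD.
set D := ray_integral _ _ x.
suff lim_I : h^-1 *: ((ray_integral a Phi \o shift x) (h *: e_ i) - ray_integral a Phi x) @[h --> 0^'] --> D.
  by split; [apply/cvg_ex; exists D|exact: cvg_lim lim_I].
apply/cvgrPdist_lt => e e0.
(* For |h| < d the segments from ray x t to ray y t stay in the smaller ball. *)
pose d := rho - `|x0 - x|.
have d0 : 0 < d by rewrite subr_gt0 -rV_ballE.
have nhd : \forall h \near (0 : R)^', `|h| < d by exact: dnbhs0_lt.
have nhe : \forall h \near (0 : R)^', `|h| < e / (K + 1).
  by apply: dnbhs0_lt; rewrite divr_gt0 // ltr_wpDl.
have nh0 : \forall h \near (0 : R)^', h != 0 by exact: nbhs_dnbhs_neq.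
apply: filterS3 nh0 nhd nhe => h h0 hd he.
pose y := h *: (e_ i : 'rV[R]_n) + x; rewrite /= -/y.
have By : B' y.
  rewrite rV_ballE /y opprD addrCA addrC; apply: le_lt_trans (ler_normB _ _) _.
  by have := norm_scale_delta h i; move: hd; rewrite /d; lra.
suff est : `|ray_integral a Phi y - ray_integral a Phi x - h * D| <= (K * `|h|) * `|h|.
  rewrite distrC.
  have -> : h^-1 *: (ray_integral a Phi y - ray_integral a Phi x) - D =
      h^-1 * (ray_integral a Phi y - ray_integral a Phi x - h * D).
    by rewrite mulrBr mulKf.
  rewrite normrM normfV ltr_pdivrMl ?normr_gt0 //.
  apply: le_lt_trans est _; rewrite mulrC ltr_pM2l ?normr_gt0 //.
  move: he; rewrite ltr_pdivlMr ?ltr_wpDl // mulrDr mulr1 mulrC.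
  by apply: le_lt_trans; rewrite lerDl.
have cy := ray_integral_cont (a := a) sP By; have cx := ray_integral_cont (a := a) sP Bx.
have cD := ray_integral_cont (a := a.+1) sD Bx.
rewrite /D /ray_integral -(integral01Z h cD) -(integral01B cy cx).
rewrite -(integral01B (cont01_sub cy cx) (cont01_scale h cD)).
apply: integral01_bound => [|t t01].
  exact: cont01_sub (cont01_sub cy cx) (cont01_scale h cD).
have /andP[t0 t1] := t01.
have -> : ray y t = (t * h) *: e_ i + ray x t.
  by rewrite /ray /y -addrA scalerDr addrA scalerA.
have -> : t ^+ a * Phi ((t * h) *: e_ i + ray x t) - t ^+ a * Phi (ray x t) -
    h * (t ^+ a.+1 * 'D_(e_ i) Phi (ray x t)) =
    t ^+ a * (Phi ((t * h) *: e_ i + ray x t) - Phi (ray x t) -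
      'D_(e_ i) Phi (ray x t) * (t * h)) by rewrite exprS; ring.
rewrite normrM ger0_norm ?exprn_ge0 // -[leRHS]mul1r.
apply: ler_pM => //; rewrite ?exprn_ge0 ?exprn_ile1 //.
have th : `|t * h| <= `|h| by rewrite normrM ger0_norm // ler_piMl.
apply: (@le_trans _ _ (K * `|h| * `|t * h|)); last by rewrite ler_wpM2l ?mulr_ge0.
apply: mean_value_line => s st _.
have sh := le_trans st th.
have Bs : B' (s *: e_ i + ray x t).
  rewrite rV_ballE opprD addrCA addrC; apply: le_lt_trans (ler_normB _ _) _.
  have := norm_scale_delta s i; have := norm_ray x t01; move: hd; rewrite /d; lra.
split; first exact: smooth_derivable sP (ball_rho_sub rho_r Bs).
apply: le_trans (HK _ _ (ray_in_ball Bx t01) Bs) _.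
rewrite addrK ler_wpM2l //; exact: le_trans (norm_scale_delta _ _) sh.
Qed.

Lemma ray_integral_smooth a Phi : smooth_on B Phi -> smooth_on B' (ray_integral a Phi).
Proof.
move=> sP k; elim: k a Phi sP => [|k IH] a Phi sP.
  by split=> // x /set_mem; exact: ray_integral_continuous.
have oB' : open B' by exact: ball_open.
apply: CkS_intro => [x|x i Bx|i]; first exact: ray_integral_continuous.
  by case: (ray_integral_derive a i sP Bx).
apply: Ck_eq (IH a.+1 _ (smooth_derive i sP)) => // x Bx.
by case: (ray_integral_derive a i sP Bx).
Qed.

(** F x - F x0 is the integral of the derivative of F along the ray from x0 to x, so
that g_i is the integral of D_i F along the ray. *)
Lemma hadamard F : smooth_on B F ->
  exists g : 'I_n -> 'rV[R]_n -> R, [/\ forall i, smooth_on B' (g i),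
    forall i, g i x0 = 'D_(e_ i) F x0 &
    forall x, B' x -> F x = F x0 + \sum_i (x - x0) 0 i * g i x].
Proof.
move=> sF; exists (fun i => ray_integral 0 (fun y => 'D_(e_ i) F y)); split=> [i|i|x Bx].
- by apply: ray_integral_smooth; exact: smooth_derive.
- have -> : ray_integral 0 (fun y => 'D_(e_ i) F y) x0 = I01 (fun=> 'D_(e_ i) F x0).
    apply: eq_Rintegral => t _.
    by rewrite expr0 mul1r /ray subrr scaler0 add0r.
  exact: integral01_cst.
have cD i : cont01 (fun t => t ^+ 0 * 'D_(e_ i) F (ray x t)).
  exact: ray_integral_cont (smooth_derive i sF) Bx.
have [c1 E1] := integral01_sum (fun i => cont01_scale ((x - x0) 0 i) (cD i)).
have dF (t : R) : 0 <= t <= 1 -> is_derive t 1 (F \o ray x)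
    (\sum_i (x - x0) 0 i * (t ^+ 0 * 'D_(e_ i) F (ray x t))).
  move=> t01.
  have -> : \sum_i (x - x0) 0 i * (t ^+ 0 * 'D_(e_ i) F (ray x t)) =
      \sum_i (x - x0) 0 i * 'D_(e_ i) F (ray x t).
    by apply: eq_bigr => i _; rewrite expr0 mul1r.
  have oB : open B by exact: ball_open.
  apply: (C1_chain oB (sF 1%N)); first exact: (ball_rho_sub rho_r (ray_in_ball Bx t01)).
  by move=> j; exact: is_derive_ray.
have := integral01_FTC dF c1; rewrite E1 /= /ray scale0r add0r scale1r subrK => E.
rewrite -[LHS](subrKC (F x0)) -E; congr (_ + _); apply: eq_bigr => i _.
by rewrite integral01Z.
Qed.

End Hadamard.

(** * Charts, smooth functions and tangent vectors *)

Section Charts.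
Context {R : realType} (T : topologicalType) (n : nat).
Implicit Types (c : chart R T n).

Local Notation e_ i := (delta_mx 0 i).

Lemma cmapK c x : is_chart c -> cdom c x -> cinv c (cmap c x) = x.
Proof. by case=> _ _ ck _ _ cx; apply: ck; exact/mem_set. Qed.

Lemma cimg_cmap c x : cdom c x -> cimg c (cmap c x).
Proof. by move=> cx; exists x. Qed.

Lemma cdom_cinv c y : is_chart c -> cimg c y -> cdom c (cinv c y).
Proof. by move=> hc [x cx <-]; rewrite cmapK. Qed.

Lemma cinvK c y : is_chart c -> cimg c y -> cmap c (cinv c y) = y.
Proof. by move=> hc [x cx <-]; rewrite cmapK. Qed.

Lemma cimg_open c : is_chart c -> open (cimg c).
Proof. by case. Qed.

Lemma cinv_continuous c y : is_chart c -> cimg c y -> {for y, continuous (cinv c)}.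
Proof. by case=> _ _ _ _ cc cy; apply: cc; exact/mem_set. Qed.

Lemma cmap_continuous c x : is_chart c -> cdom c x -> {for x, continuous (cmap c)}.
Proof. by case=> _ _ _ cc _ cx; apply: cc; exact/mem_set. Qed.

Lemma cimg_preimage c (W : set T) : is_chart c ->
  cmap c @` (cdom c `&` W) = cimg c `&` cinv c @^-1` W.
Proof.
move=> hc; apply/seteqP; split=> [y [x [cx Wx] <-]|y [cy Wy]].
  by split; [exists x|rewrite /= cmapK].
by exists (cinv c y); [split=> //; exact: cdom_cinv|exact: cinvK].
Qed.

(** This form, rather than the image of an open subset of the chart, makes openness
evident from the continuity of the inverse parametrization. *)
Lemma open_cimg_preimage c (W : set T) : is_chart c -> open W ->
  open (cimg c `&` cinv c @^-1` W).
Proof.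
move=> hc oW; rewrite openE => y [cy Wy].
have n1 : \forall z \near y, cimg c z.
  by apply: open_nbhs_nbhs; split=> //; exact: cimg_open.
have n2 : \forall z \near y, W (cinv c z).
  by apply: (cinv_continuous hc cy); exact: open_nbhs_nbhs.
by apply: (near_mono2 _ n1 n2).
Qed.

Definition extend c (g : 'rV[R]_n -> R) (x : T) : R :=
  if `[< cdom c x >] then g (cmap c x) else 0.

Lemma extend_in c g x : cdom c x -> extend c g x = g (cmap c x).
Proof. by move=> cx; rewrite /extend asboolT. Qed.

Lemma extend_out c g x : ~ cdom c x -> extend c g x = 0.
Proof. by move=> cx; rewrite /extend asboolF. Qed.

Variable M : smooth_structure R T n.

(** A point outside the chart has a neighbourhood that misses the image of K: this
image is compact, hence closed, because the manifold is Hausdorff. *)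
Lemma Cinf_extend c (K : set 'rV[R]_n) g : atlas M c -> compact K -> K `<=` cimg c ->
  smooth_on (cimg c) g -> (forall y, cimg c y -> ~ K y -> g y = 0) ->
  Cinf M (extend c g).
Proof.
move=> Ac cK Kc sg g0 c1 Ac1.
have hc := atlas_chart Ac; have hc1 := atlas_chart Ac1.
have oc1 := cimg_open hc1.
apply: smooth_local => y cy; set x := cinv c1 y.
have [cx|ncx] := pselect (cdom c x).
  exists (cimg c1 `&` cinv c1 @^-1` cdom c).
  have oV : open (cimg c1 `&` cinv c1 @^-1` cdom c).
    by apply: open_cimg_preimage => //; case: hc.
  split=> //.
  apply: (smooth_eq (f := g \o (cmap c \o cinv c1))) => // [z [cz dz]|].
    by rewrite /= extend_in.
  apply: smooth_comp oV (cimg_open hc) _ _ sg.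
    by move=> z [_ dz]; exact: cimg_cmap.
  by have := atlas_compatible Ac1 Ac; rewrite /smooth_transition cimg_preimage.
pose C := cinv c @` K.
have cC : closed C.
  apply: compact_closed; first exact: manifold_hausdorff M.
  apply: continuous_compact cK; apply: continuous_in_subspaceT => z /set_mem /Kc.
  exact: cinv_continuous.
have nCx : (~` C) x by move=> [z /Kc cz zx]; apply: ncx; rewrite -zx; exact: cdom_cinv.
exists (cimg c1 `&` cinv c1 @^-1` (~` C)).
have oV : open (cimg c1 `&` cinv c1 @^-1` (~` C)).
  by apply: open_cimg_preimage => //; exact: closed_openC.
split=> //; apply: (smooth_eq (f := fun=> 0)) => //; last exact: smooth_cst.
move=> z [_ nCz] /=; have [dz|ndz] := pselect (cdom c (cinv c1 z)); last first.
  by rewrite extend_out.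
rewrite extend_in // g0 //; first exact: cimg_cmap.
by move=> Kz; apply: nCz; exists (cmap c (cinv c1 z)) => //; exact: cmapK.
Qed.

(** The factor g is only required to be smooth on a ball slightly larger than the
support of b, as is the case for the quotients of Hadamard's lemma. *)
Lemma Cinf_extend_bump c y0 (r s : R) b g : atlas M c -> 0 < s -> s < r ->
  ball y0 r `<=` cimg c -> smooth_on setT b -> (forall y, ~ ball y0 s y -> b y = 0) ->
  smooth_on (ball y0 r) g -> Cinf M (extend c (fun y => b y * g y)).
Proof.
move=> Ac s0 sr rc sb b0 sg; pose K : set 'rV[R]_n := closed_ball_ Num.norm y0 s.
have KB y : K y -> ball y0 r y.
  by rewrite /K /closed_ball_ /= rV_ballE => h; apply: le_lt_trans sr.
have nK y : ~ K y -> b y * g y = 0.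
  move=> nKy; rewrite b0 ?mul0r // rV_ballE => h; apply: nKy.
  by rewrite /K /closed_ball_ /= ltW.
have closedK : closed K by exact: closed_closed_ball_.
apply: (@Cinf_extend c K) => //.
- exact: closed_ball_compact.
- by move=> y /KB /rc.
- apply: smooth_local => y cy; have [By|nBy] := pselect (K y).
    have oB : open (ball y0 r) by apply: ball_open; apply: lt_trans sr.
    exists (ball y0 r); split=> //; first exact: KB.
    apply: smooth_mul => //; exact: smooth_subset sb.
  exists (~` K); have oK : open (~` K) by exact: closed_openC.
  split=> //; apply: (smooth_eq (f := fun=> 0)) => //; last exact: smooth_cst.
  by move=> z nKz; rewrite nK.
- by move=> y _; exact: nK.
Qed.

Lemma Cinf_lin (a : R) f g : Cinf M f -> Cinf M g -> Cinf M (fun x => a * f x + g x).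
Proof.
move=> Cf Cg c Ac; have oc := cimg_open (atlas_chart Ac).
apply: smooth_add => //; last exact: Cg.
by apply: smooth_mul => //; [exact: smooth_cst|exact: Cf].
Qed.

Lemma Cinf_mul f g : Cinf M f -> Cinf M g -> Cinf M (fun x => f x * g x).
Proof.
move=> Cf Cg c Ac; have oc := cimg_open (atlas_chart Ac).
by apply: smooth_mul => //; [exact: Cf|exact: Cg].
Qed.

Lemma Cinf0 : Cinf M (fun=> 0).
Proof. by move=> c Ac; exact: smooth_cst. Qed.

Lemma tangent0 p v : tangent_vector M p v -> v (fun=> 0) = 0.
Proof.
move=> [vl _]; have := vl 1 _ _ Cinf0 Cinf0.
have -> : (fun x : T => 1 * (0 : R) + 0) = (fun=> 0).
  by apply: funext => x; rewrite mulr0 addr0.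
by rewrite mul1r => h; lra.
Qed.

Lemma tangent_sum p v (I : finType) (F : I -> T -> R) : tangent_vector M p v ->
  (forall i, Cinf M (F i)) -> v (fun x => \sum_i F i x) = \sum_i v (F i).
Proof.
move=> tv CF; suff [] : Cinf M (fun x => \sum_i F i x) /\
  v (fun x => \sum_i F i x) = \sum_i v (F i) by [].
elim: (index_enum I) => [|i s [IHC IH]].
  have -> : (fun x => \sum_(i <- [::]) F i x) = (fun=> 0).
    by apply: funext => x; rewrite big_nil.
  by rewrite big_nil; split; [exact: Cinf0|exact: tangent0 tv].
have -> : (fun x => \sum_(j <- i :: s) F j x) =
    (fun x => 1 * F i x + \sum_(j <- s) F j x).
  by apply: funext => x; rewrite big_cons mul1r.
split; first exact: Cinf_lin.
by case: tv => vl _; rewrite vl // mul1r IH big_cons.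
Qed.

(** By Hadamard's lemma F = sum_i (x_i - x0_i) g_i near p with g_i p = 0.  Multiplying
by the square of a bump function B turns this into a global identity F B^2 = sum_i
X_i G_i, whose right-hand side is killed by v because X_i and G_i vanish at p; and
v (F B^2) = (v F) (B p)^2 since F p = 0. *)
Lemma tangent_zero_jet p v c F : tangent_vector M p v -> atlas M c -> cdom c p ->
  Cinf M F -> F p = 0 -> (forall i, 'D_(e_ i) (F \o cinv c) (cmap c p) = 0) -> v F = 0.
Proof.
move=> tv Ac cp CF Fp dF; have hc := atlas_chart Ac.
set x0 := cmap c p in dF *.
have [r r0 rc] := open_ball_sub (cimg_open hc) (cimg_cmap cp).
have r2 : r / 2 < r by lra.
have r20 : 0 < r / 2 by lra.
have sF : smooth_on (ball x0 r) (F \o cinv c) by apply: smooth_subset rc _; exact: CF.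
have [g [sg g0 gE]] := hadamard r20 r2 sF.
have r4 : r / 4 < r / 2 by lra.
have r40 : 0 < r / 4 by lra.
have [b [sb b_gt0 b0]] := bump_exists x0 r40.
have rc2 : ball x0 (r / 2) `<=` cimg c.
  move=> y; rewrite rV_ballE => h; apply: rc; rewrite rV_ballE; exact: lt_trans r2.
have ext := Cinf_extend_bump Ac r40 r4 rc2 sb b0.
pose B := extend c (fun y => b y * 1).
pose X i := extend c (fun y => b y * (y 0 i - x0 0 i)).
pose G i := extend c (fun y => b y * g i y).
have oB2 : open (ball x0 (r / 2)) by exact: ball_open.
have CB : Cinf M B by apply: ext; exact: smooth_cst.
have CX i : Cinf M (X i).
  by apply: ext; apply: smooth_sub => //; [exact: smooth_coord|exact: smooth_cst].
have CG i : Cinf M (G i) by exact: ext.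
have E : (fun x => F x * (B x * B x)) = (fun x => \sum_i X i x * G i x).
  apply: funext => x; rewrite /B /X /G.
  have [cx|ncx] := pselect (cdom c x); last first.
    rewrite extend_out // !mulr0 big1 // => i _; by rewrite extend_out // mul0r.
  rewrite extend_in // mulr1.
  have [Bx|nBx] := pselect (ball x0 (r / 4) (cmap c x)); last first.
    rewrite b0 // !mulr0 big1 // => i _; by rewrite !extend_in // b0 // !mul0r.
  have Bx2 : ball x0 (r / 2) (cmap c x).
    by move: Bx; rewrite !rV_ballE => h; exact: lt_trans r4.
  have := gE _ Bx2; rewrite /= cmapK // cmapK // Fp add0r => ->.
  rewrite mulr_suml; apply: eq_bigr => i _.
  by rewrite !extend_in // !mxE; ring.
have [vl vm] := tv.
have Bp : 0 < B p.
  by rewrite /B extend_in // mulr1; apply: b_gt0; exact: ballxx.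
have : v (fun x => F x * (B x * B x)) = 0.
  rewrite E (tangent_sum tv); last by move=> i; exact: Cinf_mul.
  rewrite big1 // => i _; rewrite vm //.
  rewrite /X /G !extend_in // -/x0 g0 dF subrr !mulr0 mul0r.
  by rewrite addr0.
rewrite (vm F (fun x => B x * B x)) //; last exact: Cinf_mul.
rewrite Fp mul0r addr0 => /eqP; rewrite !mulf_eq0 (gt_eqF Bp) !orbF.
by move/eqP.
Qed.

End Charts.

(** * Pullback and descent of smooth functions *)

Section Submersions.
Context {R : realType} (T T' : topologicalType) (m n : nat).
Variables (M : smooth_structure R T m) (N : smooth_structure R T' n).

Local Notation e_ i := (delta_mx 0 i).

Lemma Cinf_pullback phi f : smooth_map (atlas M) (atlas N) phi -> Cinf N f ->
  Cinf M (f \o phi).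
Proof.
move=> [cphi sphi] Cf c Ac; have hc := atlas_chart Ac.
apply: smooth_local => y cy.
have [c' Ac' cq] := atlas_cover N (phi (cinv c y)); have hc' := atlas_chart Ac'.
have oW : open (phi @^-1` cdom c').
  by move: cphi => /continuousP; apply; case: hc'.
have oV := open_cimg_preimage hc oW.
exists (cimg c `&` cinv c @^-1` (phi @^-1` cdom c')); split=> //.
apply: (smooth_eq (f := (f \o cinv c') \o (cmap c' \o phi \o cinv c))) => //.
  by move=> z [_ dz] /=; rewrite cmapK.
apply: smooth_comp oV (cimg_open hc') _ _ (Cf _ Ac').
  by move=> z [_ dz]; exact: cimg_cmap.
by rewrite -cimg_preimage //; exact: sphi.
Qed.

Definition chart_expr (c : chart R T m) (c' : chart R T' n) (phi : T -> T') :=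
  cmap c' \o phi \o cinv c.

Lemma coord_tangent_vector c' q (l : 'I_n -> R) : atlas N c' -> cdom c' q ->
  tangent_vector N q
    (fun f => \sum_j l j * 'D_(e_ j) (f \o cinv c') (cmap c' q)).
Proof.
move=> Ac' cq; have hc' := atlas_chart Ac'; have cy := cimg_cmap cq.
have d f j : Cinf N f -> is_derive (cmap c' q) (e_ j) (f \o cinv c')
    ('D_(e_ j) (f \o cinv c') (cmap c' q)).
  by move=> Cf; split=> //; exact: smooth_derivable (Cf _ Ac') cy.
split=> [a f g Cf Cg|f g Cf Cg].
  rewrite mulr_sumr -big_split /=; apply: eq_bigr => j _.
  have [_ E] := is_deriveD (is_deriveZ a (d f j Cf)) (d g j Cg).
  have -> : (fun x => a * f x + g x) \o cinv c' =
    a *: (f \o cinv c') + (g \o cinv c') by [].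
  by rewrite E /GRing.scale /=; ring.
rewrite mulr_suml mulr_sumr -big_split /=; apply: eq_bigr => j _.
have [_ E] := is_deriveM (d f j Cf) (d g j Cg).
have -> : (fun x => f x * g x) \o cinv c' = (f \o cinv c') * (g \o cinv c') by [].
by rewrite E /GRing.scale /= cmapK //; ring.
Qed.

(** If J l = 0, the function f which is l . (y - y0) times a bump function has a
pullback with vanishing first-order jet at p, so it is killed by all derivations
there.  But the derivation along l at phi p lifts to p by hypothesis, and its value on
f is a positive multiple of the sum of the squares of the l_j. *)
Lemma jac_submersion_row_full phi c c' p :
  surjective_submersion M N phi -> atlas M c -> atlas N c' -> cdom c p ->
  cdom c' (phi p) -> row_full (jac (chart_expr c c' phi) (cmap c p)).
Proof.
move=> [sm _ sub] Ac Ac' cp cq; have hc := atlas_chart Ac; have hc' := atlas_chart Ac'.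
set J := jac _ _; set x0 := cmap c p.
suff ker (l : 'cV[R]_n) : J *m l = 0 -> l = 0.
  rewrite -cokermx_eq0; apply/eqP/matrixP => i j; rewrite mxE.
  have /colP/(_ i) : col j (cokermx J) = 0.
    by apply: ker; rewrite colE mulmxA mulmx_coker mul0mx.
  by rewrite !mxE.
move=> Jl; have [v tv vE] := sub p _ (coord_tangent_vector (l^~ 0) Ac' cq).
set y0 := cmap c' (phi p) in vE.
have cy := cimg_cmap cq; rewrite -/y0 in cy.
have [r r0 rc] := open_ball_sub (cimg_open hc') cy.
have r2 : r / 2 < r by lra.
have r20 : 0 < r / 2 by lra.
have [b [sb b_gt0 b0]] := bump_exists y0 r20.
pose g (y : 'rV[R]_n) : R := \sum_j l j 0 * (y 0 j - y0 0 j).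
have oB : open (ball y0 r) by exact: ball_open.
have sg (U : set 'rV[R]_n) : open U -> smooth_on U g.
  move=> oU; apply: smooth_sum => // j _; apply: smooth_mul => //.
    exact: smooth_cst.
  by apply: smooth_sub => //; [exact: smooth_coord|exact: smooth_cst].
pose f := extend c' (fun y => b y * g y).
have Cf : Cinf N f by exact: Cinf_extend_bump Ac' r20 r2 rc sb b0 (sg _ oB).
have gy0 : g y0 = 0 by rewrite /g big1 // => j _; rewrite subrr mulr0.
have dg j : 'D_(e_ j) g y0 = l j 0.
  have [_ ->] : is_derive y0 (e_ j) g (\sum_k l k 0 * ((e_ j : 'rV[R]_n) 0 k - 0)).
    apply: is_derive_sumfun => k.
    have := is_deriveZ (l k 0) (is_deriveB (is_derive_coord y0 (e_ j) k)
      (is_derive_cst (y0 0 k) y0 (e_ j))).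
    exact.
  rewrite (bigD1 j) //= big1 ?addr0 => [|k kj].
    by rewrite subr0 mxE !eqxx mulr1.
  by rewrite subr0 mxE eqxx (negPf kj) mulr0.
have db j : 'D_(e_ j) (f \o cinv c') y0 = b y0 * l j 0.
  have nE : \forall y \near y0, (f \o cinv c') y = b y * g y.
    apply: (@near_open R n (cimg c')) => //; first exact: cimg_open.
    by move=> y cy' /=; rewrite /f extend_in ?cinvK //; exact: cdom_cinv.
  rewrite (near_eq_derive _ nE).
  have d1 : is_derive y0 (e_ j) b ('D_(e_ j) b y0).
    by split=> //; exact: smooth_derivable sb _.
  have d2 : is_derive y0 (e_ j) g ('D_(e_ j) g y0).
    by split=> //; exact: smooth_derivable (sg _ oB) (ballxx _ r0).
  have [_ E] := is_deriveM d1 d2.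
  have -> : (fun y => b y * g y) = b * g by [].
  by rewrite E /GRing.scale /= gy0 dg mul0r addr0.
have fp : f (phi p) = 0 by rewrite /f extend_in // -/y0 gy0 mulr0.
have vf0 : v (f \o phi) = 0.
  apply: (tangent_zero_jet tv Ac cp _ fp); first exact: Cinf_pullback.
  move=> i; case: sm => cphi sphi.
  have oW : open (phi @^-1` cdom c').
    by move: cphi => /continuousP; apply; case: hc'.
  have oV := open_cimg_preimage hc oW.
  set V := _ `&` _ in oV; have Vx : V x0.
    by split; [exact: cimg_cmap|rewrite /= cmapK].
  have nE : \forall y \near x0, (f \o phi \o cinv c) y =
      ((f \o cinv c') \o chart_expr c c' phi) y.
    by apply: (near_open oV Vx) => y [_ dy] /=; rewrite /chart_expr /= cmapK.
  rewrite (near_eq_derive _ nE).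
  have sl : vsmooth_on V (chart_expr c c' phi) by rewrite /V -cimg_preimage //; exact: sphi.
  have lx : chart_expr c c' phi x0 = y0 by rewrite /chart_expr /= cmapK.
  rewrite (smooth_chain i (cimg_open hc') (Cf _ Ac') _ sl Vx) ?lx //.
  have /colP/(_ i) := Jl; rewrite mxE [RHS]mxE => Ji.
  transitivity (b y0 * \sum_j J i j * l j 0); last by rewrite Ji mulr0.
  rewrite mulr_sumr; apply: eq_bigr => j _.
  by rewrite db /J mxE; ring.
have := vE f Cf; rewrite /tangent_map vf0 => /esym.
under eq_bigr do rewrite db.
have by0 : 0 < b y0 by apply: b_gt0; exact: ballxx.
have -> : \sum_j l j 0 * (b y0 * l j 0) = b y0 * \sum_j l j 0 ^+ 2.
  by rewrite mulr_sumr; apply: eq_bigr => j _; ring.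
move=> /eqP; rewrite mulf_eq0 (gt_eqF by0) /= psumr_eq0 => [/allP H|j _]; last first.
  exact: sqr_ge0.
apply/colP => j; rewrite mxE; apply/eqP; rewrite -sqrf_eq0.
by have := H j; rewrite mem_index_enum => /(_ isT).
Qed.

(** With A a right inverse of the derivative of phi at p, the affine slice u A + x0
meets the fibres of phi transversally, and phi restricted to it has derivative 1
at u = 0; so [smooth_descent] applies to k in the chart downstairs. *)
Lemma Cinf_descent phi k : surjective_submersion M N phi -> Cinf M (k \o phi) ->
  Cinf N k.
Proof.
move=> sub Ck c' Ac'; have hc' := atlas_chart Ac'.
apply: smooth_local => y cy.
have [sm sur _] := sub; have [cphi sphi] := sm.
have [p pq] := sur (cinv c' y); have [c Ac cp] := atlas_cover M p.
have hc := atlas_chart Ac; set x0 := cmap c p.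
have cq : cdom c' (phi p) by rewrite pq; exact: cdom_cinv.
have [A AJ] := row_fullP (jac_submersion_row_full sub Ac Ac' cp cq).
have oW : open (phi @^-1` cdom c').
  by move: cphi => /continuousP; apply; case: hc'.
have oV := open_cimg_preimage hc oW.
set V := _ `&` _ in oV; have Vx : V x0.
  by split; [exact: cimg_cmap|rewrite /= cmapK].
pose s (u : 'rV[R]_n) : 'rV[R]_m := u *m A + x0.
have sE u j : s u 0 j = \sum_k u 0 k * A k j + x0 0 j by rewrite /s mxE [in LHS]mxE.
have ss (O : set 'rV[R]_n) : open O -> vsmooth_on O s.
  move=> oO j; apply: (smooth_eq (f := fun u => \sum_k u 0 k * A k j + x0 0 j)) => //.
  apply: smooth_add => //; last exact: smooth_cst.
  apply: smooth_sum => // l _; apply: smooth_mul => //; [exact: smooth_coord|exact: smooth_cst].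
have s0 : s 0 = x0 by rewrite /s mul0mx add0r.
pose U := s @^-1` V.
have oU : open U.
  have cs : continuous s by move=> u; apply: (vsmooth_continuous (ss _ openT)).
  by move: cs => /continuousP; apply.
have U0 : U 0 by rewrite /U /= s0.
have sl : vsmooth_on V (chart_expr c c' phi) by rewrite /V -cimg_preimage //; exact: sphi.
have spsi : vsmooth_on U (chart_expr c c' phi \o s).
  by move=> j; apply: smooth_comp oU oV _ (ss _ oU) (sl j).
have Jpsi : jac (chart_expr c c' phi \o s) 0 = 1%:M.
  rewrite -AJ; apply/matrixP => i j; rewrite !mxE.
  rewrite (smooth_chain (f := fun x => chart_expr c c' phi x 0 j) i oV (sl j) _ (ss _ oU) U0).
    rewrite s0; apply: eq_bigr => l _; rewrite [jac _ _ _ _]mxE; congr (_ * _).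
    have -> : (fun u => s u 0 l) = (fun u => \sum_k A k l * u 0 k + x0 0 l).
      by apply: funext => u; rewrite sE; congr (_ + _); apply: eq_bigr => q _; rewrite mulrC.
    have d1 : is_derive (0 : 'rV[R]_n) (e_ i) (fun u : 'rV[R]_n => \sum_k A k l * u 0 k)
        (\sum_k A k l * (e_ i : 'rV[R]_n) 0 k).
      apply: is_derive_sumfun => q.
      exact: (is_deriveZ (A q l) (is_derive_coord (0 : 'rV[R]_n) (e_ i) q)).
    have [_ ->] := is_deriveD d1 (is_derive_cst (x0 0 l) (0 : 'rV[R]_n) (e_ i)).
    rewrite addr0 (bigD1 i) //= big1 ?addr0 => [|q qi].
      by rewrite mxE !eqxx mulr1.
    by rewrite mxE eqxx (negPf qi) mulr0.
  by rewrite s0.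
have skpsi : smooth_on U ((k \o cinv c') \o (chart_expr c c' phi \o s)).
  apply: (smooth_eq (f := (k \o phi \o cinv c) \o s)) => //.
    by move=> u [_ du] /=; rewrite /chart_expr /= cmapK.
  apply: smooth_comp oU (cimg_open hc) _ (ss _ oU) (Ck _ Ac).
  by move=> u [].
have [W [oW' W0 sW]] := smooth_descent oU U0 spsi Jpsi skpsi.
exists W; split=> //.
by move: W0; rewrite /= s0 /chart_expr /= cmapK // pq cinvK.
Qed.

End Submersions.

(** * Uniqueness of integral curves *)

Section IntegralCurves.
Context {R : realType} (T : topologicalType) (n : nat) (M : smooth_structure R T n).
Variable X : T -> (T -> R) -> R.
Hypothesis vX : vector_field M X.

(** The coordinates themselves are not globally defined smooth functions.  They are
the quotients of the global functions b y_j and b, with b a bump function, and the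
quotient rule expresses their derivatives through X (b y_j) and X b. *)
Lemma chart_ode c p : atlas M c -> cdom c p ->
  exists (r : R) (G : 'I_n -> 'rV[R]_n -> R), [/\ 0 < r, ball (cmap c p) r `<=` cimg c,
    forall j, smooth_on (ball (cmap c p) r) (G j) &
    forall (gamma : R -> T) (t : R), (\forall s \near t, cdom c (gamma s) /\ ball (cmap c p) r (cmap c (gamma s))) ->
      (forall f, Cinf M f -> is_derive t 1 (f \o gamma) (X (gamma t) f)) ->
      forall j, is_derive t 1 (fun s : R => cmap c (gamma s) 0 j) (G j (cmap c (gamma t)))].
Proof.
move=> Ac cp; have hc := atlas_chart Ac; set y0 := cmap c p.
have [r r0 rc] := open_ball_sub (cimg_open hc) (cimg_cmap cp).
have r2 : r / 2 < r by lra.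
have r20 : 0 < r / 2 by lra.
have [b [sb b_gt0 b0]] := bump_exists y0 r20.
have oB : open (ball y0 r) by exact: ball_open.
pose B := extend c (fun y => b y * 1).
pose F j := extend c (fun y => b y * y 0 j).
have CB : Cinf M B.
  by apply: (Cinf_extend_bump Ac r20 r2 rc sb b0); exact: smooth_cst.
have CF j : Cinf M (F j).
  by apply: (Cinf_extend_bump Ac r20 r2 rc sb b0); exact: smooth_coord.
have BU : ball y0 (r / 2) `<=` cimg c.
  by move=> y; rewrite rV_ballE => h; apply: rc; rewrite rV_ballE; exact: lt_trans r2.
have oU : open (ball y0 (r / 2)) by exact: ball_open.
have Bgt0 q : cdom c q -> ball y0 (r / 2) (cmap c q) -> 0 < B q.
  by move=> cq Bq; rewrite /B extend_in // mulr1; exact: b_gt0.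
have sC f : Cinf M f -> smooth_on (ball y0 (r / 2)) (f \o cinv c).
  by move=> Cf; apply: smooth_subset BU _; exact: Cf.
pose G j y := F j (cinv c y) * (- (B (cinv c y))^-1 ^+ 2 * X (cinv c y) B)
  + (B (cinv c y))^-1 * X (cinv c y) (F j).
exists (r / 2), G; split => // [j|gamma t nt dt j].
  have sBi : smooth_on (ball y0 (r / 2)) (fun y => (B (cinv c y))^-1).
    apply: smooth_inv => //; last exact: (sC _ CB).
    move=> y Uy; rewrite gt_eqF // Bgt0 ?cinvK //; try exact: BU.
    exact/cdom_cinv/BU.
  have sX f : Cinf M f -> smooth_on (ball y0 (r / 2)) (fun y => X (cinv c y) f).
    by move=> Cf; exact: (sC _ (vX.2 f Cf)).
  apply: smooth_add => //; apply: smooth_mul => //; [exact: sC| |exact: sX].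
  apply: smooth_mul => //; last exact: sX.
  apply: (smooth_eq (f := fun y => (-1) * ((B (cinv c y))^-1 * (B (cinv c y))^-1))) => //.
    by move=> y _; rewrite mulN1r expr2.
  by apply: smooth_mul => //; [exact: smooth_cst|exact: smooth_mul].
have [ct Bt] := nbhs_singleton nt.
have nE : \forall s \near t, F j (gamma s) * (B (gamma s))^-1 = cmap c (gamma s) 0 j.
  apply: near_mono nt => s [cs Bs]; have := Bgt0 _ cs Bs.
  rewrite /F /B !extend_in // mulr1 => bs.
  by rewrite mulrAC mulfV ?mul1r // gt_eqF.
apply: (@near_eq_is_derive R R R _ _ t 1 _ nE).
have Bn0 : B (gamma t) != 0 by rewrite gt_eqF // Bgt0.
have dB := dt _ CB; have dF := dt _ (CF j).
have dV : is_derive t 1 (fun s => (B (gamma s))^-1)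
    (- (B (gamma t))^-1 ^+ 2 * X (gamma t) B).
  have [d1 d2] := dB; split; first exact: (@derivableV _ _ (B \o gamma)).
  by rewrite (@deriveV _ _ (B \o gamma)) // d2 /GRing.scale /= exprVn.
have := is_deriveM dF dV; rewrite /GRing.scale /= /G cmapK //.
Qed.

(** On an interval of half-length e with Lip e <= 1/2, the distance of the two coordinate
curves attains its maximum, which by the mean value theorem is at most half of
itself. *)
Lemma integral_curve_local_unique (J : set R) (g1 g2 : R -> T) (s : R) :
  open J -> J s -> integral_curve M X J g1 -> integral_curve M X J g2 ->
  g1 s = g2 s -> \forall t \near s, g1 t = g2 t.
Proof.
move=> oJ Js i1 i2 E.
have [c Ac cp] := atlas_cover M (g1 s); have hc := atlas_chart Ac.
have [r [G [r0 rc sG ode]]] := chart_ode Ac cp.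
set y0 := cmap c (g1 s) in r0 rc sG ode *.
have r2 : r / 2 < r by lra.
have r20 : 0 < r / 2 by lra.
have /choice[L HL] : forall j, exists L : R, 0 <= L /\
    forall x y, ball y0 (r / 2) x -> ball y0 (r / 2) y -> `|G j y - G j x| <= L * `|y - x|.
  by move=> j; exact: (smooth_lipschitz r20 r2 (sG j)).
pose Lip := \sum_j L j.
have Lip0 : 0 <= Lip by apply: sumr_ge0 => j _; case: (HL j).
have near_g g : integral_curve M X J g -> g s = g1 s -> \forall t \near s,
    cdom c (g t) /\ ball y0 (r / 2) (cmap c (g t)).
  move=> ig gs; have [cg _] := ig s Js.
  have n1 : \forall x \near g s, cdom c x.
    by apply: open_nbhs_nbhs; split; [case: hc|rewrite gs].
  have n2 : \forall x \near g s, ball y0 (r / 2) (cmap c x).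
    have cgs : cdom c (g s) by rewrite gs.
    apply: (cmap_continuous hc cgs); rewrite gs; exact: nbhsx_ballx.
  exact: (cg _ (near_mono2 (fun _ h1 h2 => conj h1 h2) n1 n2)).
have nJ : \forall t \near s, J t by exact: open_nbhs_nbhs.
have [d d0 dP] := near_ballP (filterI nJ (filterI (near_g g1 i1 erefl) (near_g g2 i2 (esym E)))).
pose e := Num.min (d / 2) (2 * (Lip + 1))^-1.
have e0 : 0 < e by rewrite lt_min divr_gt0 //= invr_gt0 mulr_gt0 // ltr_wpDl.
have ed : e < d by rewrite /e gt_min; apply/orP; left; lra.
have eL : Lip * e <= 2^-1.
  have : e <= (2 * (Lip + 1))^-1 by rewrite /e ge_min lexx orbT.
  move=> /(ler_wpM2l Lip0) /le_trans; apply.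
  by rewrite invfM mulrCA ger_pMr ?invr_gt0 // ler_pdivrMr ?ltr_wpDl // mul1r lerDl.
have inB t : `|t - s| <= e -> ball s d t.
  by move=> te; rewrite /ball /= distrC; apply: le_lt_trans ed.
pose u g (t : R) := cmap c (g t).
have du g j t : integral_curve M X J g -> (forall t, ball s d t -> cdom c (g t) /\
    ball y0 (r / 2) (cmap c (g t))) -> ball s d t ->
    is_derive t 1 (fun t : R => u g t 0 j) (G j (u g t)).
  move=> ig gB Bt; apply: ode => [|f Cf]; last by case: (ig t (dP t Bt).1) => _; apply.
  have oBd : open (ball s d) by exact: ball_open.
  have nB : \forall t' \near t, ball s d t' by exact: open_nbhs_nbhs.
  apply: near_mono nB => t' /gB[ct' Bt']; split=> //.
  by move: Bt'; rewrite !rV_ballE => h; exact: lt_trans r2.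
have d1 j t := du g1 j t i1 (fun t Bt => (dP t Bt).2.1).
have d2 j t := du g2 j t i2 (fun t Bt => (dP t Bt).2.2).
pose D t := u g1 t - u g2 t.
have dD j t : ball s d t -> is_derive t 1 (fun t : R => D t 0 j)
    (G j (u g1 t) - G j (u g2 t)).
  move=> Bt; have -> : (fun t : R => D t 0 j) =
      (fun t : R => u g1 t 0 j) - (fun t : R => u g2 t 0 j).
    by apply: funext => x; rewrite /D !mxE.
  exact: is_deriveB (d1 j t Bt) (d2 j t Bt).
have cD t : ball s d t -> {for t, continuous (fun t => `|D t|)}.
  move=> Bt; apply: continuous_comp; last exact: norm_continuous.
  apply: continuous_row => j; apply: differentiable_continuous.
  by apply/derivable1_diffP; case: (dD j t Bt).
have ball_in (t : R) : s - e <= t <= s + e -> `|t - s| <= e.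
  by rewrite ler_norml => /andP[h1 h2]; apply/andP; split; lra.
have se : s - e <= s + e by lra.
have cN : {within `[s - e, s + e], continuous (fun t => `|D t|)}.
  apply: continuous_in_subspaceT => t /set_mem /=; rewrite in_itv /= => /ball_in /inB.
  exact: cD.
have [c' Hc' maxc'] := EVT_max se cN.
rewrite in_itv /= in Hc'; have c'e := ball_in _ Hc'.
have Ds : D s = 0 by rewrite /D /u E subrr.
have half : `|D c'| <= 2^-1 * `|D c'|.
  apply: rV_norm_le => [|j]; first by rewrite mulr_ge0 // invr_ge0.
  have H (x : R) : (s <= x <= c') || (c' <= x <= s) ->
      is_derive x 1 (fun t => D t 0 j) (G j (u g1 x) - G j (u g2 x)) /\
      `|G j (u g1 x) - G j (u g2 x) - 0| <= Lip * `|D c'|.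
    move=> Hx.
    have xin : s - e <= x <= s + e.
      by move: Hx Hc' e0 => /orP[] /andP[? ?] /andP[? ?] ?; apply/andP; split; lra.
    have Bx := inB _ (ball_in _ xin); split; first exact: dD.
    have [_ [B1 B2]] := dP x Bx.
    rewrite subr0; have [Lj0 HLj] := HL j.
    apply: le_trans (HLj _ _ B2.2 B1.2) _; apply: ler_pM => //.
      by rewrite /Lip (bigD1 j) //= lerDl sumr_ge0 // => i _; case: (HL i).
    by apply: maxc'; rewrite in_itv.
  have := mean_value_itv H; rewrite Ds [X in _ - X - _]mxE subr0 mul0r subr0 => h.
  apply: le_trans h _; rewrite mulrAC ler_wpM2r //.
  by apply: le_trans eL; rewrite ler_wpM2l.
have D0 : `|D c'| = 0 by apply/eqP; rewrite eq_le normr_ge0 andbT; lra.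
have n_e : \forall t \near s, ball s e t by exact: nbhsx_ballx.
apply: near_mono n_e => t; rewrite /ball /= distrC => te.
have tin : s - e <= t <= s + e.
  by move: te; rewrite ltr_norml => /andP[? ?]; apply/andP; split; lra.
have := maxc' t; rewrite in_itv /= tin D0 normr_le0 subr_eq0 => /(_ isT) /eqP uE.
have [_ [[c1 _] [c2 _]]] := dP t (inB _ (ltW te)).
by rewrite -(cmapK hc c1) -(cmapK hc c2) -/(u g1 t) uE.
Qed.

(** The set where the curves agree is open by local uniqueness and closed because the
manifold is Hausdorff. *)
Lemma integral_curve_unique (J : set R) (g1 g2 : R -> T) (s : R) :
  open J -> is_interval J -> J s -> integral_curve M X J g1 -> integral_curve M X J g2 ->
  g1 s = g2 s -> forall t, J t -> g1 t = g2 t.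
Proof.
move=> oJ iJ Js i1 i2 E t Jt.
pose A := [set x | J x /\ g1 x = g2 x].
have oA : open A.
  rewrite openE => x [Jx Ex].
  have n1 : \forall y \near x, J y by exact: open_nbhs_nbhs.
  have n2 := integral_curve_local_unique oJ Jx i1 i2 Ex.
  by apply: (near_mono2 _ n1 n2).
suff : A = J by move=> AJ; move: Jt; rewrite -AJ => -[].
have cJ : connected J by apply/connected_intervalP.
apply: cJ; first by exists s.
- exists A => //; apply/seteqP; split=> [x [Jx Ex]|x [] //].
  by split.
- exists (closure A); first exact: closed_closure.
  apply/seteqP; split=> [x Ax|x [Jx clx]]; first by split; [case: Ax|exact: subset_closure].
  split=> //; apply: (manifold_hausdorff M) => U V nU nV.
  have [c1 _] := i1 x Jx; have [c2 _] := i2 x Jx.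
  have n1 : \forall y \near x, U (g1 y) by exact: c1.
  have n2 : \forall y \near x, V (g2 y) by exact: c2.
  have [y [[_ Ey] [Uy Vy]]] := clx _ (filterI n1 n2).
  by exists (g1 y); split=> //; rewrite Ey.
Qed.

Lemma flows_to_unique (t : R) z w w' : flows_to M X t z w -> flows_to M X t z w' -> w = w'.
Proof.
move=> [J1 [g1 [[oJ1 iJ1 J10 J1t] [i1 g10 <-]]]] [J2 [g2 [[oJ2 iJ2 J20 J2t] [i2 g20 <-]]]].
apply: (@integral_curve_unique (J1 `&` J2) g1 g2 0) => //.
- exact: openI.
- move=> x y [x1 x2] [y1 y2] z' xzy; split; [exact: (iJ1 x y)|exact: (iJ2 x y)].
- by move=> x [x1 _]; exact: i1.
- by move=> x [_ x2]; exact: i2.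
- by rewrite g10 g20.
Qed.

End IntegralCurves.

(** * Flows of related vector fields *)

Section RelatedFlows.
Context {R : realType} (T T' : topologicalType) (m n : nat).
Variables (M : smooth_structure R T m) (N : smooth_structure R T' n).

Lemma flows_to_related phi X Y (t : R) z w : smooth_map (atlas M) (atlas N) phi ->
  related N phi X Y -> flows_to M X t z w -> flows_to N Y t (phi z) (phi w).
Proof.
move=> sphi rel [J [g [HJ [ig g0 gt]]]]; exists J, (phi \o g); split=> //.
split; rewrite /= ?g0 ?gt //= => s Js; have [cg dg] := ig s Js; split.
  by apply: continuous_comp cg _; case: sphi => + _; apply.
move=> f Cf; rewrite -[Y _ _]rel //.
exact: (dg _ (Cinf_pullback sphi Cf)).
Qed.

(** The image of a flow line is a flow line of Y, so it ends at a point that Y can flow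
to; uniqueness identifies this point with the value of the flow map. *)
Lemma flow_related phi X Y : smooth_map (atlas M) (atlas N) phi -> vector_field N Y ->
  related N phi X Y -> forall t : R,
  flow_dom M X t `<=` phi @^-1` flow_dom N Y t /\
  forall z, flow_dom M X t z -> flow N Y t (phi z) = phi (flow M X t z).
Proof.
move=> sphi vY rel t; split=> z [w zw].
  by exists (phi w); exact: flows_to_related zw.
have zF : flows_to M X t z (flow M X t z).
  exact: (@xgetPex _ z [set w | flows_to M X t z w] (ex_intro _ w zw)).
have qF := flows_to_related sphi rel zF.
apply: (flows_to_unique vY _ qF).
exact: (@xgetPex _ (phi z) [set w | flows_to N Y t (phi z) w] (ex_intro _ _ qF)).
Qed.

End RelatedFlows.

(** * Invariant functions and the orbit space *)

Section Orbits.
Context (G : groupType) (T : topologicalType) (a : group_action G T).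

Lemma orbit_projP x y : orbit_proj a x = orbit_proj a y <-> exists g, a g x = y.
Proof.
split=> H.
  by have /eqmodP/asboolP : (x = y %[mod {eq_quot orbit_equiv a}])%qT := H.
suff : (x = y %[mod {eq_quot orbit_equiv a}])%qT by [].
by apply/eqmodP/asboolP.
Qed.

Lemma invariant_orbit_proj V (k : orbit_space a -> V) :
  invariant_fun a (k \o orbit_proj a).
Proof.
move=> g x /=; congr k; apply/orbit_projP; exists (g^-1)%g.
by rewrite -actM mulVg act1.
Qed.

Lemma orbit_proj_surj (q : orbit_space a) : exists p, orbit_proj a p = q.
Proof. by exists (repr q); exact: reprK. Qed.

Lemma invariant_descends V (f : T -> V) : invariant_fun a f ->
  exists k : orbit_space a -> V, k \o orbit_proj a = f.
Proof.
move=> inv; have /choice[s sP] := orbit_proj_surj.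
exists (f \o s); apply: funext => x /=.
by have /orbit_projP[g gs] := sP (orbit_proj a x); rewrite -[in RHS]gs inv.
Qed.

End Orbits.

(** * The reduced bracket *)

Section Reduction.
Context {R : realType} (P : topologicalType) (n : nat) (SP : smooth_structure R P n).
Context (G : groupType) (a : group_action G P).
Context (m : nat) (SQ : smooth_structure R (orbit_space a) m).
Hypothesis regular : surjective_submersion SP SQ (orbit_proj a).

Local Notation proj := (orbit_proj a).

Lemma invariant_smooth_descends f : Cinf SP f -> invariant_fun a f ->
  exists2 k, Cinf SQ k & k \o proj = f.
Proof.
move=> Cf inv; have [k kE] := invariant_descends inv; exists k => //.
by apply: (Cinf_descent regular); rewrite kE.
Qed.

Lemma comp_orbit_proj_inj (V : Type) (k l : orbit_space a -> V) :
  k \o proj = l \o proj -> k = l.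
Proof.
move=> E; apply: funext => q; have [p <-] := orbit_proj_surj q.
exact: (congr1 (@^~ p) E).
Qed.

Variable br : (P -> R) -> (P -> R) -> P -> R.
Hypothesis brP : leibniz_bracket SP br.

Lemma reduced_bracket_exists : weak_symmetry SP br a ->
  exists brQ : (orbit_space a -> R) -> (orbit_space a -> R) -> orbit_space a -> R,
    forall f g, Cinf SQ f -> Cinf SQ g ->
      brQ f g \o proj = br (f \o proj) (g \o proj).
Proof.
move=> weak; have [sproj _ _] := regular.
have /choice[s sP] := @orbit_proj_surj _ _ a.
exists (fun f g q => br (f \o proj) (g \o proj) (s q)) => f g Cf Cg.
have inv : invariant_fun a (br (f \o proj) (g \o proj)).
  apply: weak; [exact: Cinf_pullback sproj Cf|exact: Cinf_pullback sproj Cg| |];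
    exact: invariant_orbit_proj.
apply: funext => x /=.
by have /orbit_projP[h hs] := sP (proj x); rewrite -[in RHS]hs inv.
Qed.

(** Composition with the projection is injective, so the axioms are inherited from the
bracket upstairs; smoothness is the descent of smooth functions. *)
Lemma reduced_bracket_leibniz brQ :
  (forall f g, Cinf SQ f -> Cinf SQ g ->
     brQ f g \o proj = br (f \o proj) (g \o proj)) -> leibniz_bracket SQ brQ.
Proof.
move=> brE; have [sproj _ _] := regular.
have pull f : Cinf SQ f -> Cinf SP (f \o proj) := Cinf_pullback sproj.
have val f g x : Cinf SQ f -> Cinf SQ g ->
    brQ f g (proj x) = br (f \o proj) (g \o proj) x.
  by move=> Cf Cg; exact: (congr1 (@^~ x) (brE f g Cf Cg)).
split=> [f g Cf Cg|c f g h Cf Cg Ch|c f g h Cf Cg Ch|f g h Cf Cg Ch|f g h Cf Cg Ch].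
- apply: (Cinf_descent regular); rewrite brE //.
  by apply: (bracket_smooth brP); exact: pull.
- apply: comp_orbit_proj_inj; rewrite brE //; last exact: Cinf_lin.
  have := bracket_linearl brP c (pull f Cf) (pull g Cg) (pull h Ch) => E.
  by rewrite [LHS]E; apply: funext => x /=; rewrite !val.
- apply: comp_orbit_proj_inj; rewrite brE //; last exact: Cinf_lin.
  have := bracket_linearr brP c (pull f Cf) (pull g Cg) (pull h Ch) => E.
  by rewrite [LHS]E; apply: funext => x /=; rewrite !val.
- apply: comp_orbit_proj_inj; rewrite brE //; last exact: Cinf_mul.
  have := bracket_leibnizl brP (pull f Cf) (pull g Cg) (pull h Ch) => E.
  by rewrite [LHS]E; apply: funext => x /=; rewrite !val.
- apply: comp_orbit_proj_inj; rewrite brE //; last exact: Cinf_mul.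
  have := bracket_leibnizr brP (pull f Cf) (pull g Cg) (pull h Ch) => E.
  by rewrite [LHS]E; apply: funext => x /=; rewrite !val.
Qed.

End Reduction.

Theorem theorem5p5 (R : realType)
  (P : topologicalType) (n : nat) (SP : smooth_structure R P n)
  (br : (P -> R) -> (P -> R) -> P -> R) (brP : leibniz_bracket SP br)
  (G : groupTopologicalType) (d : nat) (SG : smooth_structure R G d)
  (lieG : lie_group SG)
  (a : group_action G P) (smooth_a : smooth_action SG SP a)
  (m : nat) (SQ : smooth_structure R (orbit_space a) m)
  (regular : surjective_submersion SP SQ (orbit_proj a))
  (weak : weak_symmetry SP br a) :
  let proj := orbit_proj a in
  exists brQ : (orbit_space a -> R) -> (orbit_space a -> R) -> orbit_space a -> R,
    (* (i) *)
    [/\ leibniz_bracket SQ brQ,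
        forall f g, Cinf SQ f -> Cinf SQ g ->
          brQ f g \o proj = br (f \o proj) (g \o proj) &
        forall brQ',
          (forall f g, Cinf SQ f -> Cinf SQ g ->
             brQ' f g \o proj = br (f \o proj) (g \o proj)) ->
          bracket_eq SQ brQ' brQ] /\
    (* (ii) *)
    (leibniz_map SP SQ br brQ proj /\
     forall brQ', leibniz_bracket SQ brQ' -> leibniz_map SP SQ br brQ' proj ->
       bracket_eq SQ brQ' brQ) /\
    (* (iii) *)
    forall h, Cinf SP h -> invariant_fun a h ->
      exists hQ, unique (fun k => Cinf SQ k /\ k \o proj = h) hQ /\
        forall X XQ, leibniz_vector_field SP br h X ->
          leibniz_vector_field SQ brQ hQ XQ ->
          (forall t : R,
             flow_dom SP X t `<=` proj @^-1` flow_dom SQ XQ t /\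
             forall z, flow_dom SP X t z ->
               flow SQ XQ t (proj z) = proj (flow SP X t z)) /\
          related SQ proj X XQ.
Proof.
move=> proj; have [sproj _ _] := regular.
have [brQ brE] := reduced_bracket_exists regular weak.
have uniq brQ' : (forall f g, Cinf SQ f -> Cinf SQ g ->
    brQ' f g \o proj = br (f \o proj) (g \o proj)) -> bracket_eq SQ brQ' brQ.
  move=> brE' f g Cf Cg; apply: comp_orbit_proj_inj.
  by rewrite [LHS]brE' // [RHS]brE.
exists brQ; split; first by split=> //; exact: (reduced_bracket_leibniz regular brP brE).
split; first by split=> // brQ' _ [_ brE']; exact: uniq.
move=> h Ch inv_h; have [hQ ChQ hE] := invariant_smooth_descends regular Ch inv_h.
exists hQ; split.
  by split=> // k [_ kE]; apply: comp_orbit_proj_inj; rewrite [LHS]hE -kE.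
move=> X XQ [_ XE] [vXQ XQE].
have rel : related SQ proj X XQ.
  move=> p f Cf; rewrite /tangent_map.
  have -> : XQ (proj p) f = brQ f hQ (proj p) := congr1 (@^~ (proj p)) (XQE f Cf).
  have -> : brQ f hQ (proj p) = br (f \o proj) (hQ \o proj) p :=
    congr1 (@^~ p) (brE f hQ Cf ChQ).
  rewrite [hQ \o proj]hE.
  exact: (congr1 (@^~ p) (XE _ (Cinf_pullback sproj Cf))).
by split=> //; exact: flow_related.
Qed.
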